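(* Let $(X_i)_{i\ge1}$ be i.i.d. real random variables on a probability space $(\Omega,\mathcal F,\mathbb P)$, let $S_0:=0$ and $S_n:=X_1+\cdots+X_n$ for $n\ge1$, and assume the walk $(S_n)$ is recurrent and that there are positive reals $A_n$ such that $S_n/A_n$ converges in distribution to a stable random variable $X$ of index $\alpha$ (so that $\alpha\in[1,2]$, $(A_n)$ is regularly varying of index $1/\alpha$ and $\sum_{n\ge1}1/A_n=\infty$). Assume the Cramér condition $\limsup_{|t|\to\infty}|\mathbb E[e^{itX_1}]|<1$. Let $\beta\in[2,\infty]$ be defined by $\frac1\alpha+\frac1\beta=1$, let $\Omega^*:=\{S_n\ne0\ \forall n\ge1\}$, and for $\varepsilon>0$ let $\tilde\tau_\varepsilon:=\min\{n\ge1: |S_n|<\varepsilon\}$. Then \[ \lim_{\varepsilon\to0}\frac{\log\tilde\tau_\varepsilon}{\log\varepsilon}=-\beta\quad\text{almost surely on }\Omega^*. \]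
   Context: Under these assumptions $\mathbb P(\Omega^* )>0$. For $\beta=\infty$ the conclusion reads $\log\tilde\tau_\varepsilon/\log\varepsilon\to-\infty$. *)

(* Defs.v *)
From HB Require Import structures.
From mathcomp Require Import all_boot all_order all_algebra.
From mathcomp Require Import all_classical all_reals all_analysis.
Set Implicit Arguments. Unset Strict Implicit. Unset Printing Implicit Defensive.
Import Order.TTheory GRing.Theory Num.Theory.
Import numFieldNormedType.Exports.
Local Open Scope classical_set_scope.
Local Open Scope ring_scope.

Section defs.
Context {d : measure_display} {T : measurableType d} {R : realType}.

Definition mutually_independent (P : probability T R) (X : nat -> T -> R) :=
  forall (s : seq nat) (B : nat -> set R), uniq s ->
    (forall i, i \in s -> measurable (B i)) ->
    P (\bigcap_(i in [set` s]) (X i @^-1` B i)) =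
    (\prod_(i <- s) P (X i @^-1` B i))%E.

Definition identically_distributed (P : probability T R) (X : nat -> T -> R) :=
  forall i (B : set R), measurable B -> P (X i @^-1` B) = P (X 0%N @^-1` B).

(* i.i.d. sequence of real random variables; X i stands for X_{i+1}. *)
Definition iid (P : probability T R) (X : nat -> T -> R) :=
  (forall i, measurable_fun setT (X i)) /\
  mutually_independent P X /\ identically_distributed P X.

Definition walk (X : nat -> T -> R) (n : nat) (x : T) : R :=
  \sum_(i < n) X i x.

Definition recurrent (P : probability T R) (S : nat -> T -> R) :=
  forall eps : R, 0 < eps ->
    {ae P, forall x, forall N, exists2 n, (N <= n)%N & `|S n x| < eps}.

(* tilde tau_eps = min { n >= 1 : |S_n| < eps } (set to 0 if no such n,
   which happens only on a null set under recurrence). *)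
Definition hit_time (S : nat -> T -> R) (eps : R) (x : T) : nat :=
  match pselect (exists n, ((0 < n)%N && (`|S n x| < eps))) with
  | left h => ex_minn h
  | right _ => 0%N
  end.
End defs.

Section stable.
Context {R : realType}.

Definition cf_re (mu : probability R R) (t : R) : R :=
  \int[mu]_y cos (t * y).
Definition cf_im (mu : probability R R) (t : R) : R :=
  \int[mu]_y sin (t * y).

(* Non-degenerate stable law of index alpha in (0,2], given by its
   characteristic function
   phi(t) = exp(- s^a |t|^a (1 - i b sgn(t) tan(pi a/2)) + i m t)   (a <> 1)
   phi(t) = exp(- s |t| (1 + i b (2/pi) sgn(t) ln|t|) + i m t)      (a = 1),
   with s > 0, b in [-1,1], m real; written via real/imaginary parts. *)
Definition stable_phase (alpha sigma b m t : R) : R :=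
  if alpha == 1 then m * t - sigma * b * (2 / pi) * t * ln `|t|
  else m * t + sigma `^ alpha * b * tan (pi * alpha / 2) *
               Num.sg t * `|t| `^ alpha.

Definition stable_law (alpha : R) (mu : probability R R) :=
  0 < alpha <= 2 /\
  exists sigma b m : R, 0 < sigma /\ -1 <= b <= 1 /\
    forall t : R,
      cf_re mu t = expR (- (sigma `^ alpha * `|t| `^ alpha)) *
                   cos (stable_phase alpha sigma b m t) /\
      cf_im mu t = expR (- (sigma `^ alpha * `|t| `^ alpha)) *
                   sin (stable_phase alpha sigma b m t).

Definition cvg_distribution {d} {T : measurableType d} (P : probability T R)
    (Y : nat -> T -> R) (mu : probability R R) :=
  forall f : R -> R, continuous f -> (exists M, forall y, `|f y| <= M) ->
    (\int[P]_x f (Y n x)) @[n --> \oo] --> \int[mu]_y f y.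

Definition conj_exponent (alpha : R) : \bar R :=
  if alpha == 1 then +oo%E else (alpha / (alpha - 1))%:E.
End stable.

(* Main.v *)
(* Write q(t) = |E e^{itX_1}|^2, so that |E e^{itS_n}|^2 = q(t)^n.

   Norming constants.  Convergence to the stable law gives
   q(t / A_n)^n -> exp(-a t^alpha), uniformly on compact sets of t >= 0; the phase
   of the stable law plays no role.  Comparing the indices n and 2n yields
   A_{2n} / A_n -> 2^{1/alpha}, hence A_n = n^{1/alpha + o(1)}.  Together with the
   Cramer condition, which is transported to every t <> 0 by
   1 - q(2t) <= 4 (1 - q(t)), it also yields 1 - q(u) >= c min(u, 1)^{alpha'} for
   every alpha' > alpha.

   Lower bound on the hitting time.  A finite trigonometric sum dominating the
   indicator of (-eps, eps) gives
   P(|S_n| < eps) <= 16 w eps + 4 exp(- c n w^{alpha'} / 2) for every small w.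
   With w close to n^{-1/alpha}, Borel-Cantelli over dyadic blocks of n gives
   |S_n| >= n^{-s} eventually, for every s > 1 - 1/alpha.  For alpha < 1 this
   contradicts recurrence.

   Upper bound.  For an interval I of length eps, the events "S_n is in I and
   |S_{n+k} - S_n| >= eps for 1 <= k <= M", n <= M, are disjoint.  Summing over the
   intervals that cover [-L, L] gives
   P(tau_eps > M) sum_{n <= M} P(|S_n| <= L) <= 2 L / eps + 1.  With L of order
   M^{1/alpha + o(1)}, Borel-Cantelli along M = 2^k gives min_{1 <= n <= M} |S_n| <
   M^{-s} eventually, for every s < 1 - 1/alpha.  No local limit theorem is needed. *)
Require Import Defs.
From HB Require Import structures.
From mathcomp Require Import all_boot all_order all_algebra.
From mathcomp Require Import all_classical all_reals all_analysis.
From mathcomp Require Import measurable_realfun.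
From mathcomp Require Import ring lra zify.
Import Order.TTheory GRing.Theory Num.Theory.
Import numFieldNormedType.Exports.
Local Open Scope classical_set_scope.
Local Open Scope ring_scope.

(** * Integrals of bounded functions and products of independent variables *)

Lemma bounded_integrable {d} {T : measurableType d} {R : realType}
    (P : probability T R) (f : T -> R) (M : R) :
  measurable_fun setT f -> (forall x, `|f x| <= M) ->
  P.-integrable setT (EFin \o f).
Proof.
move=> mf bf; apply: measurable_bounded_integrable => //.
  by rewrite (le_lt_trans (probability_le1 P measurableT))// ltry.
by exists M; split => [|y My x _]; [exact: num_real|exact: (le_trans (bf x) (ltW My))].
Qed.

(** Independence is given on rectangles only; uniqueness of the product measure identifies the joint
    law of [U] and [V] with the product of their laws, and Fubini then splits the integral. *)
Lemma expectation_indep_mul {d} {T : measurableType d} {R : realType}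
    (P : probability T R) (U V : T -> R) (f g : R -> R) (M : R) :
  measurable_fun setT U -> measurable_fun setT V ->
  measurable_fun setT f -> measurable_fun setT g ->
  (forall x, `|f x| <= M) -> (forall x, `|g x| <= M) ->
  (forall A B, measurable A -> measurable B ->
     P (U @^-1` A `&` V @^-1` B) = (P (U @^-1` A) * P (V @^-1` B))%E) ->
  \int[P]_x (f (U x) * g (V x)) = (\int[P]_x f (U x)) * (\int[P]_x g (V x)).
Proof.
move=> mU mV mf mg bf bg indep.
pose U' : {mfun T >-> R} := HB.pack U (isMeasurableFun.Build _ _ _ _ U mU).
pose V' : {mfun T >-> R} := HB.pack V (isMeasurableFun.Build _ _ _ _ V mV).
have mUV : measurable_fun setT (fun x => (U x, V x)) by exact/measurable_fun_pair.
pose W : {mfun T >-> (R * R)%type} :=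
  HB.pack (fun x => (U x, V x)) (isMeasurableFun.Build _ _ _ _ _ mUV).
have fU_int : P.-integrable setT (EFin \o (f \o U)).
  by apply: (@bounded_integrable _ _ _ _ _ M) => //;
    [exact: measurableT_comp|by move=> x; rewrite ?bf ?bg].
have gV_int : P.-integrable setT (EFin \o (g \o V)).
  by apply: (@bounded_integrable _ _ _ _ _ M) => //;
    [exact: measurableT_comp|by move=> x; rewrite ?bf ?bg].
have mF : measurable_fun setT (fun z : R * R => f z.1 * g z.2).
  by apply: measurable_funM; [exact: (measurableT_comp mf measurable_fst)|
    exact: (measurableT_comp mg measurable_snd)].
have bF (z : R * R) : `|f z.1 * g z.2| <= M * M.
  by rewrite normrM ler_pM.
have joint : (\int[P]_x ((f (U x) * g (V x))%:E) =
    \int[distribution P U' \x distribution P V']_z ((f z.1 * g z.2)%:E))%E.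
  transitivity (\int[distribution P W]_z ((f z.1 * g z.2)%:E))%E.
    rewrite integral_distribution//; first exact/measurable_EFinP.
    apply: (@bounded_integrable _ _ _ _ _ (M * M)) => //.
    exact: (measurableT_comp mF).
  apply: eq_measure_integral => A mA _; apply/esym.
  by apply: product_measure_unique => // B C mB mC; exact: indep.
rewrite {1}/Rintegral joint -integral12_prod_meas1; last first.
  apply/integrableP; split; first exact/measurable_EFinP.
  apply: (@le_lt_trans _ _ (\int[distribution P U' \x distribution P V']_z (M * M)%:E)%E).
    apply: ge0_le_integral => //=; last by move=> z _; rewrite lee_fin bF.
    by apply/measurable_EFinP; exact: measurableT_comp.
  rewrite integral_cst//= -setXTT product_measure1E//.
  have dT (Y : {mfun T >-> R}) : distribution P Y setT = 1%E := probability_setT _.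
  by move: (dT U') (dT V') => /= -> ->; rewrite !mule1 ltry.
rewrite /Rintegral -fineM; [|exact: integrable_fin_num..].
congr fine.
set G := (\int[P]_x (g (V x))%:E)%E.
have Gfin : G \is a fin_num by exact: (integrable_fin_num _ gV_int).
transitivity (\int[distribution P U']_u ((f u)%:E * G))%E.
  apply: eq_integral => u _; rewrite /fubini_F /=.
  transitivity (\int[distribution P V']_v ((f u)%:E * (g v)%:E))%E; first by [].
  rewrite integralZl//; last exact: (@bounded_integrable _ _ _ (distribution P V') _ M).
  by rewrite integral_distribution//; exact/measurable_EFinP.
rewrite -[in LHS](fineK Gfin) integralZr//; last first.
  exact: (@bounded_integrable _ _ _ (distribution P U') _ M).
by rewrite integral_distribution// ?fineK//; exact/measurable_EFinP.
Qed.

(** * Independence of the past and the future of the walk *)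

(** Rectangles constraining finitely many coordinates: a pi-system containing the whole space that
    generates the product sigma-algebra used on [paths R]. *)
Definition cylinders {R : realType} : set (set (nat -> R)) :=
  [set E | exists B N, [/\ forall i, measurable (B i : set R),
     forall i, (N <= i)%N -> B i = setT &
     E = [set w | forall i, B i (w i)]]].

Notation paths R := (g_sigma_algebraType (@cylinders R)).

Lemma cylinders_setI {R : realType} : setI_closed (@cylinders R).
Proof.
move=> _ _ [B [N [mB BT ->]]] [C [M [mC CT ->]]].
exists (fun i => B i `&` C i), (maxn N M); split.
- by move=> i; exact: measurableI.
- by move=> i; rewrite geq_max => /andP[Ni Mi]; rewrite BT// CT// setTI.
- apply/seteqP; split => w /=; first by move=> [Bw Cw] i; split.
  by move=> BCw; split => i; have [] := BCw i.
Qed.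

Lemma cylinders_setT {R : realType} : @cylinders R setT.
Proof.
by exists (fun=> setT), 0%N; split => //; apply/esym/seteqP; split.
Qed.

Lemma measurable_coord {R : realType} (i : nat) :
  measurable_fun setT (fun w : paths R => w i).
Proof.
move=> _ A mA; rewrite setTI; apply: sub_sigma_algebra.
exists (fun j => if j == i then A else setT), i.+1; split.
- by move=> j; case: ifP.
- by move=> j ij; rewrite gtn_eqF.
- apply/seteqP; split => w /=; first by move=> Aw j; case: eqP => [->|].
  by move=> /(_ i); rewrite eqxx.
Qed.

Lemma measurable_paths {d} {T : measurableType d} {R : realType}
    (Y : T -> paths R) :
  (forall i, measurable_fun setT (fun x => Y x i)) -> measurable_fun setT Y.
Proof.
move=> mY; apply: (@measurability _ _ _ (paths R) _ _ cylinders) => //.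
move=> _ [_ [B [N [mB BT ->]]] <-].
rewrite setTI (_ : _ @^-1` _ = \bigcap_i ((fun x => Y x i) @^-1` B i)); last first.
  by apply/seteqP; split => x /= h i; [move=> _|]; exact: h.
apply: bigcap_measurable => [|i _]; first by exists 0%N.
by rewrite -[X in measurable X]setTI; exact: mY.
Qed.

(** Both sides are finite measures in [E], namely the law of [Y] restricted to [A] and a multiple of
    the law of [Z]; agreement on the pi-system of cylinders forces equality. Allowing [Z] to differ
    from [Y] gives independence and equality of laws at once. *)
Lemma paths_indep {d} {T : measurableType d} {R : realType}
    (P : probability T R) (Y Z : T -> paths R) (A : set T) :
  measurable_fun setT Y -> measurable_fun setT Z -> measurable A ->
  (forall E, cylinders E -> P (A `&` Y @^-1` E) = P A * P (Z @^-1` E))%E ->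
  forall E : set (paths R), measurable E ->
    (P (A `&` Y @^-1` E) = P A * P (Z @^-1` E))%E.
Proof.
move=> mY mZ mA AYZ E mE.
pose Z' : {mfun T >-> paths R} := HB.pack Z (isMeasurableFun.Build _ _ _ _ Z mZ).
have PA0 : 0 <= fine (P A) by rewrite fine_ge0.
pose mrestrY := [the {measure set _ -> \bar R} of pushforward (mrestr P mA) Y].
pose m1 := mrestrY mY.
pose m2 := [the {measure set _ -> \bar R} of mscale (NngNum PA0) (distribution P Z')].
have m12 : forall F : set (paths R), cylinders F -> m1 F = m2 F.
  move=> F cF; rewrite /m1 /m2 /= /mscale /= /mrestr /pushforward /= setIC AYZ//.
  by rewrite fineK// fin_num_measure.
have := measure_unique (T := paths R) cylinders (fun=> setT) erefl cylinders_setI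
  (fun=> cylinders_setT) _ m1 m2 m12 _ E mE.
rewrite /m1 /m2 /= /mscale /= /mrestr /pushforward /= => mE1; rewrite setIC mE1.
- by rewrite fineK// fin_num_measure.
- by apply/seteqP; split => // x _; exists 0%N.
- move=> _; rewrite preimage_setT setTI.
  by rewrite (le_lt_trans (probability_le1 P mA))// ltry.
Qed.

Section iid_blocks.
Context {d : measure_display} {T : measurableType d} {R : realType}.
Variables (P : probability T R) (X : nat -> T -> R).
Hypothesis iidX : iid P X.

Let mX i : measurable_fun setT (X i). Proof. by case: iidX. Qed.

Definition future n (x : T) : paths R := fun i => X (n + i)%N x.
(** The coordinates from [n] on are frozen at 0, so that past and future live in the same path
    space. *)
Definition past n (x : T) : paths R := fun i => if (i < n)%N then X i x else 0.

Lemma measurable_future n : measurable_fun setT (future n).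
Proof. by apply: measurable_paths => i; exact: mX. Qed.

Lemma measurable_past n : measurable_fun setT (past n).
Proof.
by apply: measurable_paths => i; rewrite /past; case: (i < n)%N => //; exact: mX.
Qed.

Lemma iid_cylinder n (B : nat -> set R) : (forall i, measurable (B i)) ->
  P [set x | forall i, (i < n)%N -> B i (X i x)] =
  (\prod_(0 <= i < n) P (X 0%N @^-1` B i))%E.
Proof.
move=> mB; have [_ [indep idd]] := iidX.
have := indep (iota 0 n) B (iota_uniq _ _) (fun i _ => mB i).
rewrite /index_iota subn0 (eq_bigr (fun i => P (X 0%N @^-1` B i))); last first.
  by move=> i _; exact: idd.
move=> <-; congr (P _); apply/seteqP; split => x /=.
  by move=> BX i /=; rewrite mem_iota/= => /BX.
by move=> BX i ni; apply: (BX i); rewrite /= mem_iota.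
Qed.

Lemma measurable_cylinder n (B : nat -> set R) : (forall i, measurable (B i)) ->
  measurable [set x | forall i, (i < n)%N -> B i (X i x)].
Proof.
move=> mB.
rewrite (_ : [set _ | _] = \bigcap_(i in [set i | (i < n)%N]) (X i @^-1` B i)) //.
apply: bigcap_measurableType => i _.
by rewrite -[X in measurable X]setTI; exact: mX.
Qed.

Lemma past_cylinder_future n (B : nat -> set R) (C : set (paths R)) :
  (forall i, measurable (B i)) -> measurable C ->
  (P ([set x | forall i, (i < n)%N -> B i (X i x)] `&` future n @^-1` C) =
   P [set x | forall i, (i < n)%N -> B i (X i x)] * P (future 0 @^-1` C))%E.
Proof.
move=> mB; apply: paths_indep; [exact: measurable_future..| |].
  exact: measurable_cylinder.
move=> _ [{}C [N [mC CT ->]]].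
(* [D] concatenates the constraints on the first [n] coordinates with the shifted constraints on the
   future, so the intersection is a single cylinder whose probability factors. *)
pose D i := if (i < n)%N then B i else C (i - n)%N.
have mD i : measurable (D i) by rewrite /D; case: ifP.
transitivity (P [set x | forall i, (i < n + N)%N -> D i (X i x)]).
  congr (P _); apply/seteqP; split => x /=.
    move=> [BX CX] i _; rewrite /D; case: ltnP => [/BX//|ni].
    by have := CX (i - n)%N; rewrite /future subnKC.
  move=> DX; split=> [i ni|i].
    by have := DX i; rewrite /D ni; apply; exact: ltn_addr.
  have [iN|Ni] := ltnP i N; last by rewrite CT.
  have := DX (n + i)%N; rewrite /D ltn_add2l iN ltnNge leq_addr addKn; exact.
rewrite iid_cylinder// (big_cat_nat (leq0n n) (leq_addr N n)) /=.
congr mule; first rewrite iid_cylinder//.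
  by apply: eq_big_nat => i /andP[_ ni]; rewrite /D ni.
rewrite -{1}[n]addn0 addnC big_addn -addnBAC// subnn add0n.
transitivity (P [set x | forall i, (i < N)%N -> C i (X i x)]).
  rewrite iid_cylinder//; apply: eq_big_nat => i _.
  by rewrite /D ltnNge leq_addl addnK.
congr (P _); apply/seteqP; split => x /= CX i.
  by have [iN|Ni] := ltnP i N; [exact: CX|rewrite CT].
by move=> _; exact: CX.
Qed.

Lemma future_law n (C : set (paths R)) : measurable C ->
  P (future n @^-1` C) = P (future 0 @^-1` C).
Proof.
move=> mC.
have /= := @past_cylinder_future n (fun=> setT) C (fun=> measurableT) mC.
rewrite (_ : [set x | _] = setT) ?setTI ?probability_setT ?mul1e//.
by apply/seteqP; split.
Qed.

(** Second use of [paths_indep]: the future event is now the fixed set, and the past is extended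
    from cylinders to all measurable sets. *)
Lemma past_future n (E C : set (paths R)) : measurable E -> measurable C ->
  (P (past n @^-1` E `&` future n @^-1` C) =
   P (past n @^-1` E) * P (future 0 @^-1` C))%E.
Proof.
move=> mE mC; rewrite setIC muleC -(future_law n)//.
apply: paths_indep mE; [exact: measurable_past..| |].
  by rewrite -[X in measurable X]setTI; exact: measurable_future.
move=> _ [B [N [mB BT ->]]].
have [B0|/existsNP[i /not_implyP[ni B0]]] :=
    pselect (forall i, (n <= i)%N -> B i 0); last first.
  rewrite (_ : past n @^-1` _ = set0) ?setI0 ?measure0 ?mule0//.
  by apply/seteqP; split => // x /= /(_ i); rewrite /past ltnNge ni.
rewrite (_ : past n @^-1` _ = [set x | forall i, (i < n)%N -> B i (X i x)]).
  by rewrite setIC past_cylinder_future// muleC (future_law n).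
apply/seteqP; split => x /= BX i.
  by move=> ni; have := BX i; rewrite /past ni.
by rewrite /past; case: ltnP => [/BX//|/B0].
Qed.

End iid_blocks.

(** * Characteristic functions and concentration *)

Section trigonometric_inequalities.
Context {R : realType}.
Implicit Types x y : R.

Lemma cos_lipschitz x y : `|cos x - cos y| <= `|x - y|.
Proof.
wlog xy : x y / x <= y.
  move=> H; have [xy|yx] := leP x y; first exact: H.
  by rewrite distrC (distrC x); apply: H; exact: ltW.
have [z _ zE] : exists2 z, z \in `[x, y] & cos y - cos x = - sin z * (y - x).
  apply: MVT_segment => //; exact/continuous_subspaceT/continuous_cos.
by rewrite distrC zE normrM normrN (distrC x) ler_piMl// sin_max.
Qed.

Lemma sin_lipschitz x y : `|sin x - sin y| <= `|x - y|.
Proof.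
wlog xy : x y / x <= y.
  move=> H; have [xy|yx] := leP x y; first exact: H.
  by rewrite distrC (distrC x); apply: H; exact: ltW.
have [z _ zE] : exists2 z, z \in `[x, y] & sin y - sin x = cos z * (y - x).
  apply: MVT_segment => //; exact/continuous_subspaceT/continuous_sin.
by rewrite distrC zE normrM (distrC x) ler_piMl// cos_max.
Qed.

Lemma cos_ge_half x : `|x| <= 1 / 2 -> 1 / 2 <= cos x.
Proof.
move=> x12; have := cos_lipschitz x 0; rewrite cos0 subr0 => /le_trans/(_ x12).
by rewrite ler_norml; lra.
Qed.

Lemma measurable_cosZ {d} {T : measurableType d} (t : R) (U : T -> R) :
  measurable_fun setT U -> measurable_fun setT (fun x : T => cos (t * U x)).
Proof.
move=> mU; apply: (measurableT_comp (f := @cos R)).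
  by apply: continuous_measurable_fun; exact: continuous_cos.
exact: (measurableT_comp (mulrl_measurable t)).
Qed.

Lemma measurable_sinZ {d} {T : measurableType d} (t : R) (U : T -> R) :
  measurable_fun setT U -> measurable_fun setT (fun x : T => sin (t * U x)).
Proof.
move=> mU; apply: (measurableT_comp (f := @sin R)).
  by apply: continuous_measurable_fun; exact: continuous_sin.
exact: (measurableT_comp (mulrl_measurable t)).
Qed.

End trigonometric_inequalities.

Section expectation.
Context {d : measure_display} {T : measurableType d} {R : realType}.
Variable P : probability T R.

Lemma expectation_sum {I : Type} (r : seq I) (f : I -> T -> R) (M : R) :
  (forall i, measurable_fun setT (f i)) -> (forall i x, `|f i x| <= M) ->
  \int[P]_x (\sum_(i <- r) f i x) = \sum_(i <- r) \int[P]_x f i x.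
Proof.
move=> mf bf; elim: r => [|i r IH].
  rewrite big_nil; under eq_Rintegral do rewrite big_nil.
  by rewrite Rintegral_cst// mul0r.
rewrite big_cons -IH; under eq_Rintegral do rewrite big_cons.
rewrite RintegralD//; first exact: (@bounded_integrable _ _ _ _ _ M).
apply: (@bounded_integrable _ _ _ _ _ (\sum_(i <- r) M)).
  exact: measurable_sum.
by move=> x; apply: le_trans (ler_norm_sum _ _ _) _; exact: ler_sum.
Qed.

Lemma expectation_norm_le1 (f : T -> R) : measurable_fun setT f ->
  (forall x, `|f x| <= 1) -> `|\int[P]_x f x| <= 1.
Proof.
move=> mf bf; apply: le_trans (le_normr_Rintegral _ _) _ => //.
  exact: (@bounded_integrable _ _ _ _ _ 1).
have -> : 1 = \int[P]_x (1 : R).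
  by rewrite Rintegral_cst//= probability_setT mulr1.
apply: le_Rintegral => //.
  by apply: (@bounded_integrable _ _ _ _ _ 1);
    [exact: measurableT_comp|move=> x; rewrite normr_id].
by apply: (@bounded_integrable _ _ _ _ _ 1) => // x; rewrite normr1.
Qed.

Lemma expectation_indicator (A : set T) (c : R) : measurable A ->
  \int[P]_x (c * \1_A x) = c * fine (P A).
Proof.
move=> mA; rewrite RintegralZl//; last first.
  apply: (@bounded_integrable _ _ _ _ _ 1) => // x.
  by rewrite indicE; case: (_ \in _); rewrite ?normr1 ?normr0.
by congr (_ * fine _); rewrite integral_indic// setIT.
Qed.

(* [cfsq U t] is the squared modulus of the characteristic function of [U]. *)
Definition cfsq (U : T -> R) (t : R) : R :=
  (\int[P]_x cos (t * U x)) ^+ 2 + (\int[P]_x sin (t * U x)) ^+ 2.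

Lemma cfsq_ge0 U t : 0 <= cfsq U t.
Proof. by rewrite addr_ge0// sqr_ge0. Qed.

Definition independent (U V : T -> R) := forall A B, measurable A -> measurable B ->
  P (U @^-1` A `&` V @^-1` B) = (P (U @^-1` A) * P (V @^-1` B))%E.

Section two_variables.
Variables (U V : T -> R).
Hypotheses (mU : measurable_fun setT U) (mV : measurable_fun setT V).
Hypothesis indepUV : independent U V.

Let mcos t : measurable_fun setT (fun y : R => cos (t * y)).
Proof. by apply: measurable_cosZ; exact: measurable_id. Qed.

Let msin t : measurable_fun setT (fun y : R => sin (t * y)).
Proof. by apply: measurable_sinZ; exact: measurable_id. Qed.

Local Ltac trig := first
  [exact: measurable_cosZ|exact: measurable_sinZ|exact: cos_max|exact: sin_max].

Let prod_integrable (f g : T -> R) : measurable_fun setT f -> measurable_fun setT g ->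
  (forall x, `|f x| <= 1) -> (forall x, `|g x| <= 1) ->
  P.-integrable setT (EFin \o (fun x => f x * g x)).
Proof.
move=> mf mg bf bg; apply: (@bounded_integrable _ _ _ _ _ 1).
  exact: measurable_funM.
by move=> x; rewrite normrM mulr_ile1.
Qed.

Lemma cfsqD t : cfsq (fun x => U x + V x) t = cfsq U t * cfsq V t.
Proof.
rewrite /cfsq.
under eq_Rintegral do rewrite mulrDr cosD.
under [X in _ + X ^+ 2]eq_Rintegral do rewrite mulrDr sinD.
rewrite RintegralB//; last 2 first.
  - by apply: prod_integrable => [||x|x]; trig.
  - by apply: prod_integrable => [||x|x]; trig.
rewrite RintegralD//; last 2 first.
  - by apply: prod_integrable => [||x|x]; trig.
  - by apply: prod_integrable => [||x|x]; trig.
have cc := @expectation_indep_mul _ _ _ P U V _ _ 1 mU mV (mcos t) (mcos t)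
  (fun=> cos_max _) (fun=> cos_max _) indepUV.
have ss := @expectation_indep_mul _ _ _ P U V _ _ 1 mU mV (msin t) (msin t)
  (fun=> sin_max _) (fun=> sin_max _) indepUV.
have cs := @expectation_indep_mul _ _ _ P U V _ _ 1 mU mV (mcos t) (msin t)
  (fun=> cos_max _) (fun=> sin_max _) indepUV.
have sc := @expectation_indep_mul _ _ _ P U V _ _ 1 mU mV (msin t) (mcos t)
  (fun=> sin_max _) (fun=> cos_max _) indepUV.
rewrite cc ss cs sc; ring.
Qed.

(** The squared modulus of a characteristic function is the characteristic function of the
    symmetrised variable [U - V], where [V] is an independent copy of [U]. *)
Lemma cfsq_sym t : (forall f : R -> R, measurable_fun setT f ->
    (forall y, `|f y| <= 1) -> \int[P]_x f (V x) = \int[P]_x f (U x)) ->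
  cfsq U t = \int[P]_x cos (t * (U x - V x)).
Proof.
move=> VU.
under [RHS]eq_Rintegral do rewrite mulrBr cosB.
rewrite RintegralD//; last 2 first.
  - by apply: prod_integrable => [||x|x]; trig.
  - by apply: prod_integrable => [||x|x]; trig.
have cc := @expectation_indep_mul _ _ _ P U V _ _ 1 mU mV (mcos t) (mcos t)
  (fun=> cos_max _) (fun=> cos_max _) indepUV.
have ss := @expectation_indep_mul _ _ _ P U V _ _ 1 mU mV (msin t) (msin t)
  (fun=> sin_max _) (fun=> sin_max _) indepUV.
rewrite cc ss (VU _ (mcos t) (fun=> cos_max _)) (VU _ (msin t) (fun=> sin_max _)).
by rewrite -!expr2.
Qed.

End two_variables.

(* On [|S| < eps] the trigonometric sum [sum_{j < N} e^{i j w S}] has modulus at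
   least [N / 2]; the expectation of its squared modulus is a double sum of
   values of the characteristic function. *)
Lemma concentration (S : T -> R) (N : nat) (w eps b : R) :
  measurable_fun setT S -> (0 < N)%N -> 0 < w -> 0 < eps ->
  N%:R * w * eps <= 1 / 2 ->
  (forall m, (0 < m)%N -> \int[P]_x cos (m%:R * w * S x) <= b) -> 0 <= b ->
  fine (P [set x | `|S x| < eps]) <= 4 / N%:R + 4 * b.
Proof.
move=> mS N0 w0 e0 Nwe cosb b0.
have mA : measurable [set x | `|S x| < eps].
  have := @measurable_fun_ltr _ _ _ setT (fun x => `|S x|) (fun=> eps) _ _ measurableT.
  rewrite (_ : [set x | _] = (fun x => `|S x| < eps) @^-1` [set true]) //.
  rewrite -[X in measurable X]setTI; apply => //.
  exact: measurableT_comp.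
have NR0 : 0 < N%:R :> R by rewrite ltr0n.
pose F (p : 'I_N * 'I_N) x := cos ((p.1%:R - p.2%:R) * w * S x).
have mF p : measurable_fun setT (F p) by exact: measurable_cosZ.
have bF p x : `|F p x| <= 1 by exact: cos_max.
have FE x : \sum_(p <- index_enum _) F p x =
    (\sum_(j < N) cos (j%:R * w * S x)) ^+ 2 + (\sum_(j < N) sin (j%:R * w * S x)) ^+ 2.
  rewrite !expr2 !big_distrlr /= -big_split /= -(pair_bigA _ (fun i j => F (i, j) x)) /=.
  apply: eq_bigr => i _; rewrite -big_split/=; apply: eq_bigr => j _.
  by rewrite /F /= !mulrBl cosB.
(* Each diagonal pair contributes 1. An off-diagonal pair is a cosine expectation at a nonzero
   multiple of [w], made positive by evenness of the cosine, and is at most [b]. *)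
have EF : \int[P]_x (\sum_(p <- index_enum _) F p x) <= N%:R + N%:R ^+ 2 * b.
  rewrite (@expectation_sum _ _ _ 1)//.
  rewrite -(pair_bigA _ (fun i j => \int[P]_x F (i, j) x)) /=.
  apply: (@le_trans _ _ (\sum_(i < N) (1 + N%:R * b))); last first.
    by rewrite sumr_const card_ord -[_ *+ N]mulr_natl mulrDr mulr1 expr2 mulrA.
  apply: ler_sum => i _; rewrite (bigD1 i)//=; apply: lerD.
    under eq_Rintegral do rewrite /F /= subrr !mul0r cos0.
    by rewrite Rintegral_cst//= probability_setT mulr1.
  apply: (@le_trans _ _ (\sum_(j < N | j != i) b)); last first.
    rewrite sumr_const -[_ *+ _]mulr_natl ler_wpM2r// ler_nat.
    by rewrite -[X in (_ <= X)%N]card_ord; exact: max_card.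
  apply: ler_sum => j; rewrite -(inj_eq val_inj) neq_ltn => /orP[ji|ij].
    rewrite (_ : \int[P]_x _ = \int[P]_x cos ((i - j)%N%:R * w * S x)).
      by apply: cosb; rewrite subn_gt0.
    by apply: eq_Rintegral => x _; rewrite /F natrB// ltnW.
  rewrite (_ : \int[P]_x _ = \int[P]_x cos ((j - i)%N%:R * w * S x)).
    by apply: cosb; rewrite subn_gt0.
  apply: eq_Rintegral => x _; rewrite /F -[LHS]cosN natrB//; last exact: ltnW.
  by rewrite -!mulNr opprB.
have : N%:R ^+ 2 / 4 * fine (P [set x | `|S x| < eps]) <= N%:R + N%:R ^+ 2 * b.
  apply: le_trans EF; rewrite -expectation_indicator//; apply: le_Rintegral => //.
  - apply: (@bounded_integrable _ _ _ _ _ (N%:R ^+ 2 / 4)).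
      by apply: measurable_funM => //; exact: measurable_cst.
    move=> x; rewrite normrM ger0_norm ?divr_ge0 ?sqr_ge0//.
    by rewrite ler_piMr ?divr_ge0 ?sqr_ge0// indicE;
      case: (_ \in _); rewrite ?normr1 ?normr0.
  - apply: (@bounded_integrable _ _ _ _ _ (\sum_(p <- index_enum ('I_N * 'I_N)%type) 1)).
      exact: measurable_sum.
    by move=> x; apply: le_trans (ler_norm_sum _ _ _) _; apply: ler_sum => p _.
  - move=> x _; rewrite FE indicE; case: (boolP (x \in _)) => [|_]; last first.
      by rewrite mulr0 addr_ge0// sqr_ge0.
    rewrite inE /= mulr1 => Sx; rewrite -[leLHS]addr0 lerD ?sqr_ge0//.
    (* All phases are at most 1/2, so every cosine is at least 1/2 and the cosine sum alone reaches
       N/2. *)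
    have jwS (j : 'I_N) : `|j%:R * w * S x| <= 1 / 2.
      apply: le_trans Nwe; rewrite normrM ler_pM// ?(ltW Sx)//.
      rewrite ger0_norm ?mulr_ge0 ?(ltW w0)// ler_pM2r// ler_nat.
      exact: ltnW.
    have -> : N%:R ^+ 2 / 4 = (N%:R / 2) ^+ 2 :> R by field.
    rewrite ler_sqr ?nnegrE ?divr_ge0//; last first.
      by apply: sumr_ge0 => j _; have := cos_ge_half _ (jwS j); lra.
    have -> : N%:R / 2 = \sum_(j < N) (1 / 2) :> R.
      by rewrite sumr_const card_ord -[RHS]mulr_natl mul1r.
    apply: ler_sum => j _; exact: cos_ge_half.
move=> H; rewrite -(ler_pM2l (_ : 0 < N%:R ^+ 2 / 4)) ?divr_gt0 ?exprn_gt0//.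
apply: le_trans H _; rewrite le_eqVlt; apply/orP; left; apply/eqP.
by field; rewrite gt_eqF.
Qed.

End expectation.

(** * The walk: characteristic function, spectral gap and restart at a fixed time *)

Section iid_walk.
Context {d : measure_display} {T : measurableType d} {R : realType}.
Variables (P : probability T R) (X : nat -> T -> R).
Hypothesis iidX : iid P X.

Let mX i : measurable_fun setT (X i). Proof. by case: iidX. Qed.

(** The walk as a functional on path space, so that events about it become events of [past] and
    [future]. *)
Definition psum (n : nat) (w : paths R) : R := \sum_(i < n) w i.

Lemma measurable_psum n : measurable_fun setT (psum n).
Proof. by apply: measurable_sum => i; exact: measurable_coord. Qed.

Lemma measurable_walk n : measurable_fun setT (walk X n).
Proof. by apply: measurable_sum. Qed.

Lemma walkS n x : walk X n.+1 x = walk X n x + X n x.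
Proof. by rewrite /walk big_ord_recr. Qed.

Lemma walk_past n x : walk X n x = psum n (past X n x).
Proof. by apply: eq_bigr => i _; rewrite /past ltn_ord. Qed.

Lemma walk_future n k x : walk X (n + k) x = walk X n x + psum k (future X n x).
Proof. by rewrite /walk big_split_ord. Qed.

Lemma walk_indep n : independent P (walk X n) (X n).
Proof.
move=> A B mA mB.
have := @past_future _ _ _ P X iidX n (psum n @^-1` A) ((fun w => w 0%N) @^-1` B).
rewrite (_ : past X n @^-1` _ = walk X n @^-1` A); last first.
  by apply/seteqP; split => x /=; rewrite walk_past.
rewrite -(future_law P X iidX n).
  rewrite (_ : future X n @^-1` _ = X n @^-1` B).
    by apply; rewrite -[X in measurable X]setTI;
      [exact: measurable_psum|exact: measurable_coord].
  by apply/seteqP; split => x /=; rewrite /future addn0.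
by rewrite -[X in measurable X]setTI; exact: measurable_coord.
Qed.

Lemma identical_expectation (f : R -> R) n : measurable_fun setT f ->
  (forall y, `|f y| <= 1) -> \int[P]_x f (X n x) = \int[P]_x f (X 0%N x).
Proof.
move=> mf bf; have [_ [_ idd]] := iidX.
pose Xn m : {mfun T >-> R} := HB.pack (X m) (isMeasurableFun.Build _ _ _ _ _ (mX m)).
have EX m : (\int[P]_x (f (X m x))%:E = \int[distribution P (Xn m)]_y (f y)%:E)%E.
  rewrite integral_distribution//; first exact/measurable_EFinP.
  apply: (@bounded_integrable _ _ _ _ _ 1) => //; exact: measurableT_comp.
rewrite /Rintegral !EX; congr fine; apply: eq_measure_integral => A mA _.
exact: idd.
Qed.

(** This is the function q(t) of the overview. *)
Definition stepsq (t : R) : R := cfsq P (X 0%N) t.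

Lemma cfsq_step n t : cfsq P (X n) t = stepsq t.
Proof.
have mid : measurable_fun setT (@id R) by exact: measurable_id.
rewrite /stepsq /cfsq.
rewrite (@identical_expectation (fun y => cos (t * y)))//;
  [|exact: measurable_cosZ|by move=> y; exact: cos_max].
by rewrite (@identical_expectation (fun y => sin (t * y)))//;
  [exact: measurable_sinZ|move=> y; exact: sin_max].
Qed.

Lemma cfsq_walk n t : cfsq P (walk X n) t = stepsq t ^+ n.
Proof.
elim: n => [|n IH].
  rewrite /cfsq expr0.
  under eq_Rintegral do rewrite /walk big_ord0 mulr0 cos0.
  under [X in _ + X ^+ 2]eq_Rintegral do rewrite /walk big_ord0 mulr0 sin0.
  by rewrite !Rintegral_cst//= probability_setT mul0r mulr1 expr1n expr0n addr0.
rewrite exprSr -IH -(cfsq_step n) -cfsqD//.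
- by rewrite (_ : walk X n.+1 = fun x => walk X n x + X n x)//;
    apply/funext => x; exact: walkS.
- exact: measurable_walk.
- exact: walk_indep.
Qed.

Lemma stepsq_sym t : stepsq t = \int[P]_x cos (t * (X 0%N x - X 1%N x)).
Proof.
apply: cfsq_sym => //; last by move=> f mf bf; exact: identical_expectation.
have := walk_indep 1.
by rewrite (_ : walk X 1 = X 0%N)//; apply/funext => x; rewrite /walk big_ord1.
Qed.

Lemma stepsq_le1 t : stepsq t <= 1.
Proof.
rewrite stepsq_sym; apply: le_trans (ler_norm _) _.
apply: expectation_norm_le1; last by move=> x; exact: cos_max.
by apply: measurable_cosZ; exact: measurable_funB.
Qed.

Lemma stepsq_ge0 t : 0 <= stepsq t. Proof. exact: cfsq_ge0. Qed.

(* [1 - cos (2 y) <= 4 (1 - cos y)], applied to the symmetrised step. *)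
Lemma stepsq_double t : 1 - stepsq (2 * t) <= 4 * (1 - stepsq t).
Proof.
have mXX : measurable_fun setT (fun x => X 0%N x - X 1%N x) by exact: measurable_funB.
suff : 4 * stepsq t - 3 <= stepsq (2 * t) by lra.
rewrite !stepsq_sym -RintegralZl//; last first.
  by apply: (@bounded_integrable _ _ _ _ _ 1) => [|x];
    [exact: measurable_cosZ|exact: cos_max].
have -> : 3 = \int[P]_x (3 : R) by rewrite Rintegral_cst//= probability_setT mulr1.
rewrite -RintegralB//; last 2 first.
- apply: (@bounded_integrable _ _ _ _ _ (4 * 1)) => [|x].
    by apply: measurable_funM => //; exact: measurable_cosZ.
  by rewrite /= normrM ger0_norm// ler_pM2l//; exact: cos_max.
- by apply: (@bounded_integrable _ _ _ _ _ 3) => // x; rewrite ger0_norm.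
apply: le_Rintegral => //.
- apply: (@bounded_integrable _ _ _ _ _ (4 * 1 + 3)) => [|x].
    by apply: measurable_funB => //; apply: measurable_funM => //; exact: measurable_cosZ.
  apply: le_trans (ler_normB _ _) _; apply: lerD; last by rewrite ger0_norm.
  by rewrite normrM ger0_norm// ler_pM2l//; exact: cos_max.
- by apply: (@bounded_integrable _ _ _ _ _ 1) => [|x];
    [exact: measurable_cosZ|exact: cos_max].
- move=> x _; rewrite -[2 * t * _]mulrA.
  rewrite [2 * (t * _)]mulr_natl cos_mulr2n; set c := cos _; rewrite -subr_ge0.
  rewrite (_ : _ - _ = 2 * (1 - c) ^+ 2); last by ring.
  by rewrite mulr_ge0// sqr_ge0.
Qed.

Lemma stepsq_double_iter j t : 1 - stepsq (2 ^+ j * t) <= 4 ^+ j * (1 - stepsq t).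
Proof.
elim: j => [|j IH]; first by rewrite !expr0 !mul1r.
rewrite !exprS -!mulrA; apply: le_trans (stepsq_double _) _.
by rewrite ler_pM2l.
Qed.

(** Doubling [t] a fixed number [j] of times carries any [t >= u] beyond the threshold [M], where
    the Cramér bound holds; the doubling inequality loses only the factor 4^j. *)
Lemma cramer_gap (c M : R) : c < 1 ->
  (forall t, M < `|t| -> Num.sqrt (stepsq t) <= c) ->
  forall u, 0 < u -> exists2 k, 0 < k & forall t, u <= t -> k <= 1 - stepsq t.
Proof.
move=> c1 cramer u u0.
have [j jM] : exists j, M < 2 ^+ j * u.
  have jM := archi_boundP (normr_ge0 (M / u)).
  exists (Num.bound `|M / u|); rewrite -ltr_pdivrMr//.
  apply: le_lt_trans (ler_norm _) _; apply: lt_le_trans jM _.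
  by rewrite -natrX ler_nat ltnW// ltn_expl.
(* A square root lies below [c], so [c] is nonnegative; this is what makes its square smaller than
   1. *)
have c0 : 0 <= c.
  have ju0 : 0 <= 2 ^+ j * u by rewrite mulr_ge0 ?exprn_ge0// ltW.
  have := cramer (2 ^+ j * u); rewrite ger0_norm// => /(_ jM).
  by apply: le_trans; exact: sqrtr_ge0.
have j0 : 0 < 4 ^+ j :> R by rewrite exprn_gt0.
exists ((1 - c ^+ 2) / 4 ^+ j).
  by rewrite divr_gt0// subr_gt0 expr_lt1.
move=> t ut; rewrite ler_pdivrMr// mulrC; apply: le_trans (stepsq_double_iter j t).
rewrite lerD2l lerN2 -(sqr_sqrtr (stepsq_ge0 _)) ler_sqr ?nnegrE ?sqrtr_ge0//.
apply: cramer; rewrite ger0_norm; last by rewrite mulr_ge0 ?exprn_ge0// (le_trans (ltW u0)).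
by apply: lt_le_trans jM _; rewrite ler_pM2l ?exprn_gt0.
Qed.

(** The event that the hitting time of (-eps, eps) exceeds [M]. *)
Definition avoids (M : nat) (eps : R) : set T :=
  [set x | forall k, (0 < k <= M)%N -> eps <= `|walk X k x|].

Lemma measurable_avoids_path M eps :
  measurable [set w : paths R | forall k, (0 < k <= M)%N -> eps <= `|psum k w|].
Proof.
rewrite (_ : [set _ | _] = \bigcap_(k in [set k | (0 < k <= M)%N])
    [set w | eps <= `|psum k w|])//.
apply: bigcap_measurableType => k _.
have := @measurable_fun_ler _ _ _ setT (fun=> eps) (fun w : paths R => `|psum k w|)
  (measurable_cst _) (measurableT_comp (@normr_measurable R _) (measurable_psum k)).
by move=> /(_ measurableT [set true] I); rewrite setTI.
Qed.

Lemma measurable_avoids M eps : measurable (avoids M eps).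
Proof.
have := measurable_future P X iidX 0 measurableT _ (measurable_avoids_path M eps).
by rewrite setTI.
Qed.

(** The Markov property at the fixed time [n]: the position is a function of the past, the later
    increments a function of the future. *)
Lemma walk_restart n M (eps : R) (I : set R) : measurable I ->
  (P (walk X n @^-1` I `&`
     [set x | forall k, (0 < k <= M)%N -> (eps <= `|walk X (n + k) x - walk X n x|)%R]) =
   P (walk X n @^-1` I) * P (avoids M eps))%E.
Proof.
move=> mI; have := @past_future _ _ _ P X iidX n (psum n @^-1` I) _ _
  (measurable_avoids_path M eps).
rewrite (_ : past X n @^-1` _ = walk X n @^-1` I); last first.
  by apply/seteqP; split => x /=; rewrite walk_past.
rewrite (_ : future X n @^-1` _ =
  [set x | forall k, (0 < k <= M)%N -> eps <= `|walk X (n + k) x - walk X n x|]).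
  by apply; rewrite -[X in measurable X]setTI; exact: measurable_psum.
by apply/seteqP; split => x /= h k /h; rewrite walk_future addrC addKr.
Qed.

End iid_walk.

(** * Growth of the norming constants *)

Lemma ltr_pow2R {R : realType} (x y : R) : (2 `^ x < 2 `^ y) = (x < y).
Proof. by rewrite /powR pnatr_eq0 /= ltr_expR ltr_pM2r// ln_gt0// ltr1n. Qed.

Lemma exprn_unbounded {R : realType} (rho b : R) : 1 < rho ->
  exists j, b <= rho ^+ j.
Proof.
move=> rho1; have r1 : 0 < rho - 1 by rewrite subr_gt0.
have bern n : 1 + n%:R * (rho - 1) <= rho ^+ n.
  elim: n => [|n IH]; first by rewrite mul0r addr0 expr0.
  rewrite exprS; apply: (@le_trans _ _ (rho * (1 + n%:R * (rho - 1)))); last first.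
    by rewrite ler_pM2l// (lt_trans _ rho1).
  have : 0 <= n%:R * (rho - 1) * (rho - 1) by rewrite !mulr_ge0// ltW.
  by rewrite -natr1; lra.
exists (Num.bound `|b / (rho - 1)|); apply: le_trans (bern _).
have := archi_boundP (normr_ge0 (b / (rho - 1))); set j := Num.bound _ => jb.
have := le_lt_trans (ler_norm _) jb; rewrite ltr_pdivrMr//; lra.
Qed.

Section regular_variation.
Context {R : realType}.
Variables (q : R -> R) (A : nat -> R) (a alpha : R).
Hypotheses (q_ge0 : forall t, 0 <= q t) (q_le1 : forall t, q t <= 1).
Hypotheses (A_gt0 : forall n, 0 < A n) (a_gt0 : 0 < a) (alpha_gt0 : 0 < alpha).
Let G (t : R) := expR (- (a * t `^ alpha)).
Hypothesis q_cvg : forall e B : R, 0 < e -> exists N, forall n, (N <= n)%N ->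
  forall t : R, 0 <= t <= B -> `|q (t / A n) ^+ n - G t| <= e.

Let G_gt0 t : 0 < G t. Proof. exact: expR_gt0. Qed.

Let G_le1 t : G t <= 1.
Proof. by rewrite /G expR_le1 oppr_le0 mulr_ge0 ?powR_ge0// ltW. Qed.

Let G_anti (s t : R) : 0 <= s <= t -> G t <= G s.
Proof.
move=> /andP[s0 st]; rewrite /G ler_expR lerN2 ler_pM2l//.
by apply: ge0_ler_powR; rewrite ?nnegrE ?(ltW alpha_gt0) ?(le_trans s0 st).
Qed.

(** A quarter of the gap between [y] and x^2 is a tolerance under which the strict inequality
    survives a perturbation of both [x] and [y]. *)
Let sqr_sub_gt (x y e : R) : 0 < x -> x <= 1 -> 0 <= y -> y < x ^+ 2 ->
  e = (x ^+ 2 - y) / 4 -> [/\ 0 < e, 0 < x - e & y + e < (x - e) ^+ 2].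
Proof. by move=> x0 x1 y0 yx ->; split; nra. Qed.

(** Suppose A_n > rho A_m with n <= 2m. Then q(1/A_n)^n is at least the square of q(1/A_n)^m, hence
    nearly at least G(1/rho)^2; but it is close to G(1), and 2 < rho^alpha means G(1) <
    G(1/rho)^2. *)
Lemma norming_ratio_le (rho : R) : 0 < rho -> 2 < rho `^ alpha ->
  exists N, forall m n, (N <= m)%N -> (N <= n)%N -> (n <= 2 * m)%N -> A n <= rho * A m.
Proof.
move=> rho0 rho2; set x := G rho^-1.
have yx : G 1 < x ^+ 2.
  rewrite /x /G -expRM_natl ltr_expR powR1 mulr1 mulrN ltrN2.
  rewrite mulrCA -{2}[a]mulr1 ltr_pM2l//.
  rewrite -(powR_inv1 (ltW rho0)) powRAC powR_inv1 ?powR_ge0//.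
  by rewrite ltr_pdivrMr ?mul1r// (lt_trans _ rho2).
have [e0 xe0 yex] := sqr_sub_gt _ _ _ (G_gt0 _) (G_le1 _) (ltW (G_gt0 _)) yx erefl.
set e := (_ / 4) in e0 xe0 yex.
have [N HN] := q_cvg e (Num.max 1 rho^-1) e0.
exists N => m n Nm Nn nm; rewrite leNgt; apply/negP => Amn.
have := HN n Nn 1; rewrite ler01 le_max lexx /= => /(_ isT).
rewrite ler_norml lerBlDr => /andP[_ qn].
have t0 : 0 <= A m / A n by rewrite divr_ge0 ?ltW.
have tr : A m / A n <= rho^-1.
  by rewrite ler_pdivrMr// mulrC ler_pdivlMr// mulrC ltW.
have := HN m Nm (A m / A n); rewrite t0 le_max tr orbT => /(_ isT).
rewrite mulrAC divff ?gt_eqF// ler_norml lerBrDr => /andP[qm _].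
have xq : x - e <= q (1 / A n) ^+ m.
  apply: le_trans qm; rewrite addrC lerD2l; apply: G_anti.
  by rewrite t0.
have : (x - e) ^+ 2 <= q (1 / A n) ^+ n.
  apply: (@le_trans _ _ ((q (1 / A n) ^+ m) ^+ 2)).
    by rewrite ler_sqr ?nnegrE ?exprn_ge0// ltW.
  by rewrite -exprM mulnC ler_wiXn2l.
move=> /le_trans/(_ qn); rewrite leNgt addrC => /negP; apply.
exact: yex.
Qed.

(** Suppose A_(2m) < rho A_m. Then q(1/A_m)^(2m) is close to G(A_(2m)/A_m), which is at least
    G(rho), and also close to G(1)^2; but rho^alpha < 2 means G(1)^2 < G(rho). *)
Lemma norming_ratio_ge (rho : R) : 0 < rho -> rho `^ alpha < 2 ->
  exists N, forall m, (N <= m)%N -> rho * A m <= A (2 * m)%N.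
Proof.
move=> rho0 rho2.
have yx : G 1 ^+ 2 < G rho.
  rewrite /G -expRM_natl ltr_expR powR1 mulr1 mulrN ltrN2 mulrC.
  by rewrite ltr_pM2r.
pose e := (G rho - G 1 ^+ 2) / 4.
have e0 : 0 < e by rewrite divr_gt0// subr_gt0.
have [N HN] := q_cvg e (Num.max 1 rho) e0.
exists N => m Nm; rewrite leNgt; apply/negP => Amn.
have N2m : (N <= 2 * m)%N by rewrite mul2n -addnn (leq_trans Nm)// leq_addr.
have := HN m Nm 1; rewrite ler01 le_max lexx /= => /(_ isT).
rewrite ler_norml lerBlDr => /andP[_ qm].
have t0 : 0 <= A (2 * m)%N / A m by rewrite divr_ge0 ?ltW.
have tr : A (2 * m)%N / A m <= rho by rewrite ler_pdivrMr// ltW.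
have := HN _ N2m (A (2 * m)%N / A m); rewrite t0 le_max tr orbT => /(_ isT).
rewrite mulrAC divff ?gt_eqF// ler_norml lerBrDr => /andP[qn _].
have Gr : G rho <= G (A (2 * m)%N / A m) by apply: G_anti; rewrite t0.
have qq : q (1 / A m) ^+ (2 * m) <= (G 1 + e) ^+ 2.
  rewrite mulnC exprM ler_sqr ?nnegrE ?exprn_ge0// 1?addrC//.
  by rewrite addr_ge0 ?ltW.
have := G_gt0 1; have := G_le1 1; have := G_gt0 rho; have := G_le1 rho.
have eE : e = (G rho - G 1 ^+ 2) / 4 by [].
move: qq qn Gr yx e0 eE.
set g1 := G 1; set g := G rho; set z := q _ ^+ _; set gt := G _; clearbody g1 g z gt e.
move=> zle gle ggt g1g e_gt0 eE gle1 g_gt0 g1le1 g1_gt0.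
have eg1 : e * g1 <= e by rewrite ler_piMr// ltW.
have e14 : e <= 1 / 4 by move: (sqr_ge0 g1); lra.
have ee : e * e <= e * (1 / 4) by rewrite ler_pM2l.
have : (g1 + e) ^+ 2 = g1 ^+ 2 + 2 * (e * g1) + e * e by ring.
move: (sqr_ge0 g1); lra.
Qed.

Lemma norming_growth_le (gam : R) : 1 < gam * alpha ->
  exists C N, 0 < C /\ forall n, (N <= n)%N -> A n <= C * n%:R `^ gam.
Proof.
move=> ga1.
have gam0 : 0 < gam by rewrite -(pmulr_lgt0 _ alpha_gt0) (lt_trans _ ga1).
have r0 : 0 < 2 `^ gam :> R by exact: powR_gt0.
have [|N HN] := norming_ratio_le _ r0.
  by rewrite -powRrM -[ltLHS]powRr1// ltr_pow2R.
pose M := N.+2; pose C := \sum_(i < 2 * M) A i.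
have AC i : (i < 2 * M)%N -> A i <= C.
  move=> iM; rewrite /C (bigD1 (Ordinal iM))//= lerDl.
  by apply: sumr_ge0 => j _; exact: ltW.
have C0 : 0 < C by apply: lt_le_trans (A_gt0 0) (AC _ _).
exists C, M; split => // n Mn.
(* The induction uses n - 1 in place of n: twice ([uphalf n] - 1) is at most n - 1, which absorbs
   the rounding in each halving. *)
apply: (@le_trans _ _ (C * n.-1%:R `^ gam)); last first.
  by rewrite ler_pM2l// ge0_ler_powR ?nnegrE ?ler_nat ?leq_pred// ltW.
elim/ltn_ind: n Mn => n IH Mn.
have [nM|nM] := ltnP n (2 * M).
  have one : 1 = 1 `^ gam :> R by rewrite powR1.
  apply: le_trans (AC _ nM) _; rewrite ler_pMr// {1}one.
  apply: ge0_ler_powR; rewrite ?nnegrE ?(ltW gam0)// ler1n.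
  by rewrite /M in Mn; lia.
have Mh : (M <= uphalf n)%N by rewrite uphalfE; lia.
apply: le_trans (HN (uphalf n) n _ _ _) _; rewrite ?uphalfE;
  [rewrite /M in Mh; lia|rewrite /M in Mn; lia|lia|].
rewrite -uphalfE; apply: (@le_trans _ _ (2 `^ gam * (C * (uphalf n).-1%:R `^ gam))).
  by rewrite ler_pM2l ?powR_gt0// IH// uphalfE; rewrite /M in nM; lia.
rewrite mulrCA ler_pM2l// -powRM// -natrM.
apply: ge0_ler_powR; rewrite ?nnegrE ?(ltW gam0)// ler_nat uphalfE; lia.
Qed.

(** The ratio bound is iterated along powers of two; the constant is normalised to give equality at
    the starting index [N]. *)
Lemma norming_growth_ge (gam : R) : 0 < gam -> gam * alpha < 1 ->
  exists c K, 0 < c /\ forall k, (K <= k)%N -> c * (2 `^ gam) ^+ k <= A (2 ^ k)%N.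
Proof.
move=> gam0 ga1.
have r0 : 0 < 2 `^ gam :> R by exact: powR_gt0.
have [|N HN] := norming_ratio_ge _ r0.
  by rewrite -powRrM -[ltRHS]powRr1// ltr_pow2R.
exists (A (2 ^ N)%N / (2 `^ gam) ^+ N), N; split.
  by rewrite divr_gt0// exprn_gt0.
elim=> [|k IH] Nk.
  by move: Nk; rewrite leqn0 => /eqP ->; rewrite !expr0 divr1 mulr1.
move: Nk; rewrite leq_eqVlt => /orP[/eqP <-|Nk].
  by rewrite divfK// gt_eqF// exprn_gt0.
rewrite exprS mulrCA expnS; apply: le_trans (HN _ _).
  by rewrite ler_pM2l// IH.
have Nk' : (N <= k)%N by [].
by rewrite (leq_trans Nk')// ltnW// ltn_expl.
Qed.

Lemma bernoulli_le (x : R) n : 0 <= x <= 1 -> 1 - n%:R * x <= (1 - x) ^+ n.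
Proof.
move=> /andP[x0 x1]; elim: n => [|n IH]; first by rewrite expr0 mul0r subr0.
rewrite exprS; apply: (@le_trans _ _ ((1 - x) * (1 - n%:R * x))).
  rewrite -natr1; have : 0 <= n%:R * x * x by rewrite !mulr_ge0.
  lra.
by rewrite ler_wpM2l// subr_ge0.
Qed.

Hypothesis q_gap : forall u : R, 0 < u ->
  exists2 k, 0 < k & forall t, u <= t -> k <= 1 - q t.

(* For small [u] pick the first [k] with [u A(2^k) >= 1]; then [u A(2^k)] stays
   in a fixed compact set, so [1 - q u] is of order [2^-k]. *)
Lemma one_sub_q_ge (alpha' : R) : alpha < alpha' ->
  exists2 c, 0 < c & forall w u : R, 0 < w <= 1 -> w <= u -> c * w `^ alpha' <= 1 - q u.
Proof.
move=> aa'; have a'0 : 0 < alpha' by exact: lt_trans aa'.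
(* The exponent 1/alpha' lies below 1/alpha, so A(2^k) >= c rho^k, where rho^alpha' = 2. *)
have [||c [K1 [c0 HK1]]] := norming_growth_ge alpha'^-1 _ _.
- by rewrite invr_gt0.
- by rewrite mulrC ltr_pdivrMr// mul1r.
set rho := 2 `^ alpha'^-1 in HK1.
have rho1 : 1 < rho by rewrite -[ltLHS](powRr0 2) ltr_pow2R invr_gt0.
have rho0 : 0 < rho by exact: lt_trans rho1.
(* B^alpha = 4 exceeds 2, so A(2^(k+1)) <= B A(2^k) for large k. This confines the argument of [G]
   to [1, B]. *)
pose B : R := 2 `^ (2 / alpha).
have B0 : 0 < B by exact: powR_gt0.
have [|N2 HN2] := norming_ratio_le B B0.
  rewrite /B -powRrM divfK ?gt_eqF// powR_mulrn//; lra.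
have G1 : G 1 < 1 by rewrite /G expR_lt1 oppr_lt0 powR1 mulr1.
pose e := (1 - G 1) / 2; have e0 : 0 < e by rewrite divr_gt0// subr_gt0.
have [N3 HN3] := q_cvg e B e0.
pose K := maxn K1 (maxn N2 N3).
have kexp k : (k <= 2 ^ k)%N by rewrite ltnW// ltn_expl.
have [k0 k00 Hk0] := q_gap (A (2 ^ K)%N)^-1 ltac:(by rewrite invr_gt0).
pose c1 := e * c `^ alpha' / 2.
have c10 : 0 < c1 by rewrite divr_gt0// mulr_gt0// powR_gt0.
exists (Num.min k0 c1); first by rewrite lt_min k00.
move=> w u /andP[w0 w1] wu.
have u0 : 0 < u by exact: lt_le_trans wu.
have wa0 : 0 <= w `^ alpha' by exact: powR_ge0.
have [/Hk0 uK|uK] := leP (A (2 ^ K)%N)^-1 u.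
  apply: le_trans uK; apply: (@le_trans _ _ (k0 * w `^ alpha')).
    by rewrite ler_wpM2r// ge_min lexx.
  rewrite ler_piMr ?(ltW k00)//.
  have one : 1 = 1 `^ alpha' :> R by rewrite powR1.
  by rewrite one; apply: ge0_ler_powR; rewrite ?nnegrE ?(ltW a'0) ?(ltW w0).
have exk : exists k, (K <= k)%N && (1 <= u * A (2 ^ k)%N).
  pose b := (c * u)^-1.
  have b0 : 0 < b by rewrite invr_gt0 mulr_gt0.
  have [j jb] := @exprn_unbounded _ rho b rho1.
  exists (maxn K j); rewrite leq_maxl /=.
  apply: (@le_trans _ _ (u * (c * rho ^+ maxn K j))); last first.
    by rewrite ler_pM2l// HK1// leq_max leq_maxl.
  rewrite mulrA [u * c]mulrC -ler_pdivrMl ?mulr_gt0// mulr1.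
  by apply: le_trans jb _; rewrite ler_eXn2l// leq_maxr.
(* The minimal k exceeds [K] because u A(2^K) < 1; it therefore has a predecessor, at which the
   product is still below 1. *)
case: (ex_minnP exk) => k /andP[Kk uk] kmin.
have KLk : (K < k)%N.
  rewrite ltn_neqAle Kk andbT; apply/negP => /eqP KE.
  by move: uK; rewrite -[ltRHS]mul1r ltr_pdivlMr// KE ltNge uk.
case: k Kk uk kmin KLk => // k Kk uk kmin KLk.
have uk1 : u * A (2 ^ k)%N < 1.
  rewrite ltNge; apply/negP => uk1; have := kmin k; rewrite uk1 andbT => /(_ KLk).
  by rewrite ltnn.
have [K1k N2k N3k] : [/\ (K1 <= k)%N, (N2 <= k)%N & (N3 <= k)%N].
  by move: KLk; rewrite /K ltnS !geq_max => /and3P[].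
have AB : A (2 ^ k.+1)%N <= B * A (2 ^ k)%N.
  apply: HN2; first exact: leq_trans N2k (kexp k).
    by rewrite (leq_trans _ (kexp _))// ltnW.
  by rewrite expnS.
have tB : u * A (2 ^ k.+1)%N <= B.
  apply: (@le_trans _ _ (u * (B * A (2 ^ k)%N))); first by rewrite ler_pM2l.
  by rewrite mulrCA ler_piMr// ltW.
have := HN3 (2 ^ k.+1)%N _ (u * A (2 ^ k.+1)%N).
rewrite tB (le_trans ler01 uk) mulfK ?gt_eqF//.
have N3k' : (N3 <= 2 ^ k.+1)%N by rewrite (leq_trans _ (kexp _))// ltnW.
move=> /(_ N3k' isT); rewrite ler_norml lerBlDr => /andP[_ qk].
have Gk : G (u * A (2 ^ k.+1)%N) <= G 1 by apply: G_anti; rewrite ler01.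
(* Bernoulli converts the bound q(u)^(2^(k+1)) <= G(1) + e into a lower bound of order 2^(-k) for 1
   - q(u). *)
have bern : 1 - (2 ^ k.+1)%N%:R * (1 - q u) <= q u ^+ (2 ^ k.+1).
  rewrite -{2}[q u](subKr 1); apply: bernoulli_le.
  by rewrite subr_ge0 q_le1 lerBlDr lerDl q_ge0.
have eD : e <= (2 ^ k.+1)%N%:R * (1 - q u) by move: bern qk Gk; rewrite /e; lra.
(* Since c rho^k <= A(2^k) and u A(2^k) < 1, raising u c rho^k < 1 to the power alpha' compares
   2^(-k) with u^alpha'. *)
have uc : u `^ alpha' * (c `^ alpha' * (2 ^ k)%N%:R) <= 1.
  have -> : (2 ^ k)%N%:R = (rho ^+ k) `^ alpha' :> R.
    have rA : rho `^ alpha' = 2 by rewrite /rho -powRrM mulVf ?gt_eqF// powRr1.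
    by rewrite -powR_mulrn ?(ltW rho0)// powRAC rA powR_mulrn// natrX.
  rewrite -!powRM ?mulr_ge0 ?exprn_ge0 ?(ltW c0) ?(ltW u0) ?(ltW rho0)//.
  have one : 1 = 1 `^ alpha' :> R by rewrite powR1.
  rewrite one; apply: ge0_ler_powR; rewrite ?nnegrE ?(ltW a'0)//.
    by rewrite !mulr_ge0 ?exprn_ge0 ?(ltW c0) ?(ltW u0) ?(ltW rho0).
  by apply: le_trans (ltW uk1); rewrite ler_pM2l// HK1.
have wua : w `^ alpha' <= u `^ alpha'.
  by apply: ge0_ler_powR; rewrite ?nnegrE ?(ltW a'0) ?(ltW u0) ?(ltW w0).
apply: (@le_trans _ _ (c1 * u `^ alpha')).
  apply: ler_pM => //; last by rewrite ge_min lexx orbT.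
  by rewrite le_min !ltW.
have k2 : 0 < (2 ^ k.+1)%N%:R :> R by rewrite ltr0n expn_gt0.
rewrite -(ler_pM2l k2); apply: le_trans eD.
rewrite expnS natrM /c1.
rewrite [leLHS](_ : _ = e * (u `^ alpha' * (c `^ alpha' * (2 ^ k)%N%:R))); last by field.
by rewrite ler_piMr// ltW.
Qed.

End regular_variation.

(** * Convergence of the characteristic functions *)

Section truncated_modulus.
Context {R : realType}.

(** A bound for the increments of cos(t y) and sin(t y) when t moves by at most [delta]. Being
    continuous and bounded, it has an expectation that passes to the limit in distribution. *)
Definition trunc (delta y : R) : R := Num.min 2 (delta * `|y|).

Lemma trunc_continuous delta : continuous (trunc delta).
Proof.
move=> y; apply: (@continuous_min _ _ (fun=> 2) (fun y => delta * `|y|)).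
  exact: cst_continuous.
apply: continuousM; first exact: cst_continuous.
exact: norm_continuous.
Qed.

Lemma measurable_trunc delta : measurable_fun setT (trunc delta).
Proof. by apply: continuous_measurable_fun; exact: trunc_continuous. Qed.

Lemma trunc_bounded delta y : 0 <= delta -> 0 <= trunc delta y <= 2.
Proof.
move=> d0; apply/andP; split; last by rewrite ge_min lexx.
by rewrite le_min ler0n /= mulr_ge0.
Qed.

Lemma trunc_norm delta y : 0 <= delta -> `|trunc delta y| <= 2.
Proof. by move=> d0; have /andP[t0 t2] := trunc_bounded delta y d0; rewrite ger0_norm. Qed.

(** Dominated convergence along delta = 1/(n+1), with the constant 2 as dominating function. *)
Lemma trunc_small (mu : probability R R) (e : R) : 0 < e ->
  exists2 delta, 0 < delta & \int[mu]_y trunc delta y < e.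
Proof.
move=> e0.
pose f n (y : R) : \bar R := (trunc n.+1%:R^-1 y)%:E.
have fcvg y : f ^~ y @ \oo --> 0%E.
  apply: cvg_EFin; first by near=> n.
  apply/cvgrPdist_lt => r r0; near=> n => /=.
  rewrite sub0r normrN.
  have /andP[t0 _] : 0 <= trunc n.+1%:R^-1 y <= 2 by exact: trunc_bounded.
  rewrite ger0_norm// gt_min; apply/orP; right.
  rewrite mulrC ltr_pdivrMr// -ltr_pdivrMl//.
  near: n; exists (Num.bound (r^-1 * `|y|)) => // n /= bn.
  have := archi_boundP (mulr_ge0 (ltW (_ : 0 < r^-1)) (normr_ge0 y)).
  rewrite invr_gt0 => /(_ r0) /lt_le_trans; apply.
  by rewrite ler_nat ltnW.
have := @dominated_convergence _ _ R mu setT measurableT f (cst 0%E) (cst 2%:E).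
case.
- by move=> n; apply/measurable_EFinP; exact: measurable_trunc.
- exact: measurable_cst.
- by apply: aeW => y _; exact: fcvg.
- by apply: (@bounded_integrable _ _ _ mu (cst 2) 2) => // x; rewrite ger0_norm.
- by apply: aeW => y n _; rewrite /f lee_fin trunc_norm.
move=> _ _; rewrite integral0 => /fine_cvgP[_ /cvgrPdist_lt /(_ e e0)[N _ HN]].
exists N.+1%:R^-1 => //.
have := HN N (leqnn N); rewrite /= sub0r normrN.
rewrite ger0_norm// Rintegral_ge0// => y _.
by have := trunc_bounded N.+1%:R^-1 y; rewrite invr_ge0 ler0n => /(_ isT) /andP[].
Unshelve. all: by end_near. Qed.

End truncated_modulus.

Section equicontinuity.
Context {d : measure_display} {T : measurableType d} {R : realType}.
Variables (P : probability T R) (U : T -> R).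
Hypothesis mU : measurable_fun setT U.

Let trunc_integrable delta : 0 <= delta ->
  P.-integrable setT (EFin \o (fun x => trunc delta (U x))).
Proof.
move=> d0; apply: (@bounded_integrable _ _ _ _ _ 2) => [|x]; last exact: trunc_norm.
exact: (measurableT_comp (measurable_trunc _)).
Qed.

Let diff_le (f : R -> R) s t delta : (forall x y, `|f x - f y| <= `|x - y|) ->
    (forall x, `|f x| <= 1) -> (forall t, measurable_fun setT (fun x => f (t * U x))) ->
    `|s - t| <= delta ->
  `|\int[P]_x f (s * U x) - \int[P]_x f (t * U x)| <= \int[P]_x trunc delta (U x).
Proof.
move=> lip bf mf st; have d0 : 0 <= delta by exact: le_trans st.
have if_ r : P.-integrable setT (EFin \o (fun x => f (r * U x))).
  by apply: (@bounded_integrable _ _ _ _ _ 1) => [|x]; [exact: mf|exact: bf].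
have bd x : `|f (s * U x) - f (t * U x)| <= 2.
  by rewrite (le_trans (ler_normB _ _))// -[leRHS](_ : 1 + 1 = 2) ?lerD.
rewrite -RintegralB//; apply: le_trans (le_normr_Rintegral _ _) _ => //.
  by apply: (@bounded_integrable _ _ _ _ _ 2) => //; exact: measurable_funB.
apply: le_Rintegral => //.
- apply: (@bounded_integrable _ _ _ _ _ 2) => [|x]; last by rewrite normr_id bd.
  by apply: measurableT_comp => //; exact: measurable_funB.
- exact: trunc_integrable.
move=> x _; rewrite le_min bd/=; apply: le_trans (lip _ _) _.
by rewrite -mulrBl normrM ler_wpM2r.
Qed.

(** The cosine and sine expectations each move by at most the truncated mean; squaring on [-1, 1]
    doubles this, and two squares are added. *)
Lemma cfsq_equicontinuous s t delta : `|s - t| <= delta ->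
  `|cfsq P U s - cfsq P U t| <= 4 * \int[P]_x trunc delta (U x).
Proof.
move=> st; rewrite /cfsq.
have := diff_le _ _ _ _ cos_lipschitz (@cos_max R) (fun t => measurable_cosZ t U mU) st.
have := diff_le _ _ _ _ sin_lipschitz (@sin_max R) (fun t => measurable_sinZ t U mU) st.
have cb r : `|\int[P]_x cos (r * U x)| <= 1.
  by apply: expectation_norm_le1 => [|x]; [exact: measurable_cosZ|exact: cos_max].
have sb r : `|\int[P]_x sin (r * U x)| <= 1.
  by apply: expectation_norm_le1 => [|x]; [exact: measurable_sinZ|exact: sin_max].
move: (cb s) (cb t) (sb s) (sb t).
set a := \int[P]_x cos (s * _); set b := \int[P]_x cos (t * _).
set a' := \int[P]_x sin (s * _); set b' := \int[P]_x sin (t * _).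
set I := \int[P]_x trunc _ _ => a1 b1 a1' b1' I' I1.
have sq (x y : R) : `|x| <= 1 -> `|y| <= 1 -> `|x - y| <= I -> `|x ^+ 2 - y ^+ 2| <= 2 * I.
  move=> x1 y1 xy; rewrite subr_sqr normrM mulrC ler_pM//.
  by rewrite (le_trans (ler_normD _ _))// -[leRHS](_ : 1 + 1 = 2) ?lerD.
rewrite opprD addrACA (le_trans (ler_normD _ _))//.
by rewrite (_ : 4 * I = 2 * I + 2 * I) ?lerD ?sq//; ring.
Qed.

End equicontinuity.

Section cvg_characteristic.
Context {d : measure_display} {T : measurableType d} {R : realType}.
Variables (P : probability T R) (X : nat -> T -> R) (A : nat -> R) (alpha : R).
Variable mu : probability R R.
Hypotheses (iidX : iid P X) (A_gt0 : forall n, 0 < A n).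
Hypotheses (stable_mu : stable_law alpha mu).
Hypothesis cvg_mu : cvg_distribution P (fun n x => walk X n x / A n) mu.

Let Z n x := walk X n x / A n.

Lemma measurable_normed_walk n : measurable_fun setT (Z n).
Proof.
by apply: measurable_funM => //; exact: (measurable_walk P X iidX).
Qed.

Lemma cfsq_normed_walk n t : cfsq P (Z n) t = stepsq P X (t / A n) ^+ n.
Proof.
rewrite -(cfsq_walk P X iidX) /cfsq.
by congr (_ ^+ 2 + _ ^+ 2); apply: eq_Rintegral => x _; rewrite /Z mulrCA mulrC.
Qed.

(** The phase enters through cos^2 + sin^2 = 1, and the squared exponential gives a = 2
    sigma^alpha. *)
Lemma cfsq_stable : exists2 a, 0 < a &
  forall t, cfsq mu id t = expR (- (a * `|t| `^ alpha)).
Proof.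
have [_ [sigma [b [m [s0 [_ cf]]]]]] := stable_mu.
exists (2 * sigma `^ alpha); first by rewrite mulr_gt0// powR_gt0.
move=> t; have [re im] := cf t.
rewrite /cfsq -/(cf_re mu t) -/(cf_im mu t) re im !exprMn -mulrDr cos2Dsin2 mulr1.
by rewrite -expRM_natl mulrN mulrA.
Qed.

Lemma trunc_cvg delta : 0 <= delta ->
  \int[P]_x trunc delta (Z n x) @[n --> \oo] --> \int[mu]_y trunc delta y.
Proof.
move=> d0; apply: cvg_mu; first exact: trunc_continuous.
by exists 2 => y; exact: trunc_norm.
Qed.

Lemma cfsq_cvg t : cfsq P (Z n) t @[n --> \oo] --> cfsq mu id t.
Proof.
have ct : continuous (fun y : R => t * y) by exact: mulrl_continuous.
apply: cvgD.
  apply: (@cvg_comp _ _ _ _ (fun u : R => u ^+ 2)); last exact: exprn_continuous.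
  apply: (cvg_mu (fun y => cos (t * y))); last by exists 1 => y; exact: cos_max.
  by move=> y; apply: continuous_comp; [exact: ct|exact: continuous_cos].
apply: (@cvg_comp _ _ _ _ (fun u : R => u ^+ 2)); last exact: exprn_continuous.
apply: (cvg_mu (fun y => sin (t * y))); last by exists 1 => y; exact: sin_max.
by move=> y; apply: continuous_comp; [exact: ct|exact: continuous_sin].
Qed.

(** Pointwise convergence on a finite grid of mesh [delta] extends to [0, B]. The modulus of
    continuity is uniform in large n because the truncated means converge. Two moduli and the grid
    error cost e/4 each. *)
Lemma cfsq_cvg_uniform (e B : R) : 0 < e -> exists N, forall n, (N <= n)%N ->
  forall t, 0 <= t <= B -> `|cfsq P (Z n) t - cfsq mu id t| <= e.
Proof.
move=> e0.
have [delta d0 Hd] := trunc_small mu (e / 16) ltac:(by rewrite divr_gt0).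
have [N1 _ HN1] : \forall n \near \oo, \int[P]_x trunc delta (Z n x) < e / 16.
  exact: (cvgr_lt _ (trunc_cvg delta (ltW d0))).
have grid J : exists N, forall n, (N <= n)%N -> forall j, (j <= J)%N ->
    `|cfsq P (Z n) (j%:R * delta) - cfsq mu id (j%:R * delta)| <= e / 4.
  elim: J => [|J [N HN]].
    have /cvgrPdist_le /(_ (e / 4)) := cfsq_cvg (0%:R * delta).
    move=> /(_ ltac:(by rewrite divr_gt0))[N _ HN]; exists N => n Nn j.
    by rewrite leqn0 => /eqP ->; rewrite distrC; exact: HN.
  have /cvgrPdist_le /(_ (e / 4)) := cfsq_cvg (J.+1%:R * delta).
  move=> /(_ ltac:(by rewrite divr_gt0))[M _ HM]; exists (maxn N M) => n.
  rewrite geq_max => /andP[Nn Mn] j; rewrite leq_eqVlt => /orP[/eqP ->|jJ].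
    by rewrite distrC; exact: HM.
  exact: HN.
have [N2 HN2] := grid (Num.trunc (B / delta)).
exists (maxn N1 N2) => n; rewrite geq_max => /andP[N1n N2n] t /andP[t0 tB].
pose j := Num.trunc (t / delta).
have td0 : 0 <= t / delta by rewrite divr_ge0// ltW.
have jt : `|t - j%:R * delta| <= delta.
  have /andP[j1 j2] := truncn_itv td0.
  move: j1 j2; rewrite -/j ler_pdivlMr// ltr_pdivrMr// -natr1 mulrDl mul1r => j1 j2.
  by rewrite ger0_norm ?subr_ge0// lerBlDl ltW.
have jJ : (j <= Num.trunc (B / delta))%N.
  by apply: le_truncn; rewrite ler_pM2r ?invr_gt0.
have h1 := cfsq_equicontinuous P (Z n) (measurable_normed_walk n) _ _ _ jt.
have h2 := cfsq_equicontinuous mu id (@measurable_id _ _ _) _ _ _ jt.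
have h3 := HN2 n N2n j jJ.
have h4 := HN1 n N1n.
move: h1 h2 h3 h4 Hd; rewrite /= !ler_norml; lra.
Qed.

Lemma stepsq_cvg : exists2 a, 0 < a & forall e B : R, 0 < e ->
  exists N, forall n, (N <= n)%N -> forall t : R, 0 <= t <= B ->
    `|stepsq P X (t / A n) ^+ n - expR (- (a * t `^ alpha))| <= e.
Proof.
have [a a0 Ha] := cfsq_stable; exists a => // e B e0.
have [N HN] := cfsq_cvg_uniform e B e0; exists N => n Nn t /[dup] tB /andP[t0 _].
by have := HN n Nn t tB; rewrite cfsq_normed_walk Ha (ger0_norm t0).
Qed.

(** Markov's inequality with K = 1/delta: where |S_n| > K A_n, the truncated modulus is at least 1,
    while its mean is eventually below 1/2. *)
Lemma tight_walk : exists2 K, 0 < K & exists N, forall n, (N <= n)%N ->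
  1 / 2 <= fine (P [set x | `|walk X n x| <= K * A n]).
Proof.
have [delta d0 Hd] := trunc_small mu (1 / 2) ltac:(by rewrite divr_gt0).
exists delta^-1; first by rewrite invr_gt0.
have [N _ HN] : \forall n \near \oo, \int[P]_x trunc delta (Z n x) < 1 / 2.
  exact: (cvgr_lt _ (trunc_cvg delta (ltW d0))).
exists N => n Nn.
have mE : measurable [set x | `|walk X n x| <= delta^-1 * A n].
  have := @measurable_fun_ler _ _ _ setT (fun x => `|walk X n x|) (fun=> delta^-1 * A n)
    (measurableT_comp (@normr_measurable R _) (measurable_walk P X iidX n))
    (measurable_cst _).
  by move=> /(_ measurableT [set true] I); rewrite setTI.
have PC := probability_setC P mE.
suff : fine (P (~` [set x | `|walk X n x| <= delta^-1 * A n])) <= 1 / 2.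
  rewrite PC fineB ?fin_num_measure//=; lra.
have mEC := measurableC mE.
apply: le_trans (ltW (HN n Nn)); rewrite -[leLHS]mul1r -expectation_indicator//.
apply: le_Rintegral => //.
- apply: (@bounded_integrable _ _ _ _ _ 1) => [|x].
    by apply: measurable_funM => //; exact: measurable_cst.
  by rewrite mul1r indicE; case: (_ \in _); rewrite ?normr1 ?normr0.
- apply: (@bounded_integrable _ _ _ _ _ 2) => [|x]; last by rewrite trunc_norm// ltW.
  exact: (measurableT_comp (measurable_trunc _) (measurable_normed_walk n)).
move=> x _; rewrite mul1r indicE; case: (boolP (x \in _)) => [|_]; last first.
  by have /andP[] := trunc_bounded delta (Z n x) (ltW d0).
rewrite inE /= => /negP; rewrite -ltNge => Kx.
rewrite le_min ler1n /= mulrC -ler_pdivrMr// mul1r /Z normrM normfV (gtr0_norm (A_gt0 n)).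
by rewrite ler_pdivlMr// ltW.
Qed.

End cvg_characteristic.

(** * Probability estimates *)

Section finite_probability.
Context {d : measure_display} {T : measurableType d} {R : realType}.
Variable P : probability T R.

Lemma fine_probabilityK (A : set T) : measurable A -> (fine (P A))%:E = P A.
Proof. by move=> mA; rewrite fineK// fin_num_measure. Qed.

Lemma fine_probability_union n (F : nat -> set T) (A : set T) :
  (forall i, measurable (F i)) -> measurable A -> A `<=` \big[setU/set0]_(i < n) F i ->
  fine (P A) <= \sum_(i < n) fine (P (F i)).
Proof.
move=> mF mA AF; rewrite -lee_fin fine_probabilityK// -sumEFin.
under eq_bigr do rewrite fine_probabilityK//.
by apply: content_subadditive => // k _.
Qed.

Lemma fine_probability_disjoint n (F : nat -> set T) :
  (forall i, measurable (F i)) -> trivIset `I_n F ->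
  \sum_(i < n) fine (P (F i)) <= 1.
Proof.
move=> mF tF; rewrite -lee_fin -sumEFin.
under eq_bigr do rewrite fine_probabilityK//.
have mU : measurable (\big[setU/set0]_(k < n) F k) by exact: bigsetU_measurable.
rewrite -measure_semi_additive_ord_I//; exact: probability_le1.
Qed.

Lemma borel_cantelli_geometric (F : nat -> set T) (C r : R) (K0 : nat) :
  (forall k, measurable (F k)) -> 0 <= C -> 0 <= r < 1 ->
  (forall k, (K0 <= k)%N -> fine (P (F k)) <= C * r ^+ k) ->
  {ae P, forall x, exists K, forall k, (K <= k)%N -> ~ F k x}.
Proof.
move=> mF C0 /andP[r0 r1] FC.
(* Emptying the first [K0] events makes the geometric bound valid for every index without changing
   the limsup. *)
pose F' k := if (k < K0)%N then set0 else F k.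
have mF' k : measurable (F' k) by rewrite /F'; case: ifP.
have F'C k : (P (F' k) <= (C * r ^+ k)%:E)%E.
  rewrite /F'; case: ltnP => [_|/FC FCk]; last by rewrite -fine_probabilityK// lee_fin.
  by rewrite measure0 lee_fin mulr_ge0// exprn_ge0.
have geom n : \sum_(0 <= k < n) C * r ^+ k <= C / (1 - r).
  have r10 : 0 < 1 - r by rewrite subr_gt0.
  rewrite ler_pdivlMr// -big_distrr /= -mulrA ler_piMr//.
  suff -> : (\sum_(0 <= k < n) r ^+ k) * (1 - r) = 1 - r ^+ n.
    by rewrite lerBlDr lerDl exprn_ge0.
  elim: n => [|n IH]; first by rewrite big_geq// mul0r expr0 subrr.
  by rewrite big_nat_recr//= mulrDl IH exprS; ring.
have P0 : P (lim_sup_set F') = 0%E.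
  apply: lim_sup_set_cvg0 => //.
  apply: (@le_lt_trans _ _ (C / (1 - r))%:E); last exact: ltry.
  apply: lime_le; first exact: is_cvg_nneseries.
  near=> n; apply: (@le_trans _ _ (\sum_(0 <= k < n) (C * r ^+ k)%:E)%E).
    by apply: lee_sum => k _; exact: F'C.
  by rewrite sumEFin lee_fin.
exists (lim_sup_set F'); split => //.
  apply: bigcap_measurableType => n _; exact: bigcup_measurable.
move=> x /= /forallNP nF n _.
have /existsNP[k /not_implyP[nk /contrapT Fkx]] := nF (maxn n K0).
move: nk; rewrite geq_max => /andP[nk Kk].
by exists k => //; rewrite /F' ltnNge Kk.
Unshelve. all: by end_near. Qed.

End finite_probability.

Section walk_estimates.
Context {d : measure_display} {T : measurableType d} {R : realType}.
Variables (P : probability T R) (X : nat -> T -> R).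
Hypothesis iidX : iid P X.

Lemma measurable_walk_small n (eps : R) : measurable [set x | `|walk X n x| < eps].
Proof.
have := @measurable_fun_ltr _ _ _ setT (fun x => `|walk X n x|) (fun=> eps)
  (measurableT_comp (@normr_measurable R _) (measurable_walk P X iidX n))
  (measurable_cst _).
by move=> /(_ measurableT [set true] I); rewrite setTI.
Qed.

(** Concentration with N about 1/(2 w eps). At each multiple m w the characteristic function of S_n
    has modulus q(m w)^(n/2), which 1 - x <= exp(-x) bounds by the exponential term. *)
Lemma small_ball (c alpha' w eps : R) n :
  (forall u, w <= u -> c * w `^ alpha' <= 1 - stepsq P X u) ->
  0 < w -> 0 < eps -> w * eps <= 1 / 4 ->
  fine (P [set x | `|walk X n x| < eps]) <=
    16 * (w * eps) + 4 * expR (- (n%:R * (c * w `^ alpha') / 2)).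
Proof.
move=> qw w0 e0 we.
have we0 : 0 < w * eps by rewrite mulr_gt0.
pose z := (2 * (w * eps))^-1.
have z2 : 2 <= z.
  by rewrite /z -[leRHS]mul1r ler_pdivlMr ?mulr_gt0//; lra.
have z0 : 0 <= z by lra.
pose N := Num.trunc z.
have /andP[Nz zN] : N%:R <= z < N.+1%:R by exact: truncn_itv.
have zE : z * (2 * (w * eps)) = 1 by rewrite mulVf// gt_eqF// mulr_gt0.
clearbody z.
(* As z >= 2, rounding down loses at most half, whence 4/N <= 8/z = 16 w eps. *)
have Nz2 : z / 2 <= N%:R by move: zN; rewrite -natr1; lra.
have NR0 : 0 < N%:R :> R by lra.
set b := expR _.
apply: (@le_trans _ _ (4 / N%:R + 4 * b)); last first.
  rewrite lerD2r ler_pdivrMr//.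
  apply: (@le_trans _ _ (16 * (w * eps) * (z / 2))); last first.
    by rewrite ler_pM2l// mulr_gt0.
  by move: zE; lra.
apply: (@concentration _ _ _ P _ _ w) => //.
- exact: (measurable_walk P X iidX).
- by move: NR0; rewrite ltr0n.
- rewrite -mulrA; apply: (@le_trans _ _ (z * (w * eps))).
    by rewrite ler_pM2r.
  by move: zE; lra.
- move=> m m0.
  have wm : w <= m%:R * w by rewrite -[leLHS]mul1r ler_pM2r// ler1n.
  apply: le_trans (ler_norm _) _.
  rewrite -(@ler_pXn2r _ 2)// ?nnegrE ?expR_ge0// real_normK ?num_real//.
  apply: (@le_trans _ _ (stepsq P X (m%:R * w) ^+ n)).
    by rewrite -(cfsq_walk P X iidX) /cfsq lerDl sqr_ge0.
  rewrite -expRM_natl (_ : 2%:R * _ = n%:R * (- (c * w `^ alpha'))); last by field.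
  rewrite expRM_natl lerXn2r ?nnegrE ?expR_ge0 ?(stepsq_ge0 P X)//.
  by apply: le_trans (expR_ge1Dx _); have := qw _ wm; lra.
- exact: expR_ge0.
Qed.

(* For a cell [[y, y + eps)], the events "S_n is in the cell and the walk
   restarted at time n stays eps-away from its starting point up to time M",
   n <= M, are disjoint. *)
Lemma avoids_cell (M : nat) (eps y : R) :
  fine (P (avoids X M eps)) *
    (\sum_(n < M.+1) fine (P (walk X n @^-1` [set z | y <= z < y + eps]))) <= 1.
Proof.
pose I := [set z : R | y <= z < y + eps].
have mI : measurable I.
  rewrite (_ : I = `[y, (y + eps)[%classic); first exact: measurable_itv.
  by apply/seteqP; split => z /=; rewrite in_itv.
have mSI n : measurable (walk X n @^-1` I).
  by rewrite -[X in measurable X]setTI; apply: (measurable_walk P X iidX).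
pose E n := walk X n @^-1` I `&`
  [set x | forall k, (0 < k <= M)%N -> eps <= `|walk X (n + k) x - walk X n x|].
have mE n : measurable (E n).
  apply: measurableI => //.
  have := measurable_future P X iidX n measurableT _ (measurable_avoids_path M eps).
  rewrite setTI (_ : _ @^-1` _ =
    [set x | forall k, (0 < k <= M)%N -> eps <= `|walk X (n + k) x - walk X n x|])//.
  by apply/seteqP; split => x /= h k /h; rewrite walk_future addrC addKr.
have PE n : fine (P (E n)) = fine (P (walk X n @^-1` I)) * fine (P (avoids X M eps)).
  rewrite (walk_restart P X iidX)// fineM// fin_num_measure//.
  exact: (measurable_avoids P X iidX).
rewrite mulrC mulr_suml; under eq_bigr do rewrite -/I -PE.
apply: fine_probability_disjoint => //.
(* Two positions in the same cell differ by less than [eps], against the restart condition at k = j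
   - i, which is at most [M]. *)
have disj i j : (i < j)%N -> (j < M.+1)%N -> E i `&` E j = set0.
  move=> ij jM; apply/seteqP; split => // x [[/= Ii Hi] [/= Ij _]].
  have := Hi (j - i)%N; rewrite subn_gt0 ij subnKC ?(ltnW ij)//.
  rewrite (leq_trans (leq_subr _ _)) ?ltnS// => /(_ isT).
  by rewrite leNgt ltr_norml; move: Ii Ij; rewrite /I /= => ? ?; case/negP; lra.
apply/trivIsetP => i j /= iM jM; rewrite neq_ltn => /orP[ij|ji]; first exact: disj.
by rewrite setIC; exact: disj.
Qed.

Lemma avoids_bound (M : nat) (eps L : R) : 0 < eps -> 0 <= L ->
  fine (P (avoids X M eps)) *
    (\sum_(n < M.+1) fine (P [set x | `|walk X n x| <= L])) <= 2 * L / eps + 1.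
Proof.
move=> e0 L0.
(* The [J + 1] half-open cells starting at -L cover [-L, L], and J <= 2 L / eps. *)
pose J := Num.trunc (2 * L / eps).
have z0 : 0 <= 2 * L / eps by rewrite !mulr_ge0// invr_ge0 ltW.
have /andP[Jz _] : J%:R <= 2 * L / eps < J.+1%:R by exact: truncn_itv.
pose y j : R := - L + j%:R * eps.
pose I j := [set z : R | y j <= z < y j + eps].
have mSI j n : measurable (walk X n @^-1` I j).
  rewrite -[X in measurable X]setTI; apply: (measurable_walk P X iidX) => //.
  rewrite (_ : I j = `[y j, (y j + eps)[%classic); first exact: measurable_itv.
  by apply/seteqP; split => z /=; rewrite in_itv.
have mL n : measurable [set x | `|walk X n x| <= L].
  have := @measurable_fun_ler _ _ _ setT (fun x => `|walk X n x|) (fun=> L)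
    (measurableT_comp (@normr_measurable R _) (measurable_walk P X iidX n))
    (measurable_cst _).
  by move=> /(_ measurableT [set true] Logic.I); rewrite setTI.
have p0 : 0 <= fine (P (avoids X M eps)) by rewrite fine_ge0.
apply: (@le_trans _ _ (fine (P (avoids X M eps)) *
    (\sum_(n < M.+1) \sum_(j < J.+1) fine (P (walk X n @^-1` I j))))).
  rewrite ler_wpM2l//; apply: ler_sum => n _.
  apply: (fine_probability_union P J.+1 (fun j => walk X n @^-1` I j)) => //.
  rewrite -(bigcup_mkord J.+1 (fun j => walk X n @^-1` I j)) => x /= xL.
  have xL0 : 0 <= (walk X n x + L) / eps.
    by rewrite divr_ge0 ?(ltW e0)//; move: xL; rewrite ler_norml; lra.
  exists (Num.trunc ((walk X n x + L) / eps)) => /=.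
    rewrite ltnS; apply: le_truncn; rewrite ler_pM2r ?invr_gt0//.
    by move: xL; rewrite ler_norml; lra.
  have /andP[] := truncn_itv xL0; rewrite ler_pdivlMr// ltr_pdivrMr//.
  rewrite -[_.+1%:R]natr1; set j := Num.trunc _; rewrite mulrDl mul1r /I /y /=.
  by move=> j1 j2; apply/andP; split; lra.
rewrite exchange_big /= mulr_sumr.
apply: (@le_trans _ _ (\sum_(j < J.+1) 1)).
  by apply: ler_sum => j _; exact: avoids_cell.
by rewrite sumr_const card_ord -[1 *+ J.+1]natr1 lerD2r.
Qed.

End walk_estimates.

Lemma exprn_powR {R : realType} (x a : R) k : 0 <= x -> (x ^+ k) `^ a = (x `^ a) ^+ k.
Proof.
by move=> x0; rewrite -(powR_mulrn k x0) powRAC powR_mulrn// powR_ge0.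
Qed.

(** * Almost sure bounds along dyadic times *)

Section almost_sure_bounds.
Context {d : measure_display} {T : measurableType d} {R : realType}.
Variables (P : probability T R) (X : nat -> T -> R) (A : nat -> R) (alpha : R).
Variable mu : probability R R.
Hypotheses (iidX : iid P X) (A_gt0 : forall n, 0 < A n).
Hypotheses (stable_mu : stable_law alpha mu).
Hypothesis cvg_mu : cvg_distribution P (fun n x => walk X n x / A n) mu.

Let alpha_gt0 : 0 < alpha. Proof. by case: stable_mu => /andP[]. Qed.

(** One term of the exponential series suffices: it turns the exponential error into a geometric one
    of any prescribed ratio. *)
Let expRN_le (x : R) m : 0 < x -> expR (- x) <= m.+1`!%:R / x ^+ m.+1.
Proof.
move=> x0; rewrite expRN -[leLHS]mul1r ler_pdivrMr ?expR_gt0//.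
rewrite mulrAC ler_pdivlMr ?exprn_gt0// mul1r.
have := expR_ge1Dxn m (ltW x0).
have f0 : 0 < m.+1`!%:R :> R by rewrite ltr0n fact_gt0.
rewrite -(ler_pM2l f0) mulrDr mulrCA divff ?gt_eqF// !mulr1.
by apply: le_trans; rewrite lerDr ltW.
Qed.

(** Union bound over a dyadic block with eps = 2^(-s k) and w = 2^(-g2 k). The linear terms sum to
    order 2^(k (1 - g2 - s)); the exponential ones are controlled because n w^alpha' grows
    geometrically when alpha' = 1/g1 and g2 < g1. *)
Lemma eventually_away (c0 M s : R) : c0 < 1 ->
  (forall t, M < `|t| -> Num.sqrt (stepsq P X t) <= c0) ->
  1 - alpha^-1 < s ->
  {ae P, forall x, exists K, forall k, (K <= k)%N -> forall n, (2 ^ k <= n < 2 ^ k.+1)%N ->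
     (2 `^ (- s)) ^+ k <= `|walk X n x|}.
Proof.
move=> c01 cramer s1; pose g := alpha^-1.
have g0 : 0 < g by rewrite invr_gt0.
(* The exponents are chosen as max(1 - s, 0) < g2 < g1 < 1/alpha; the hypothesis on [s] leaves room
   for them. *)
pose p := Num.max (1 - s) 0.
have pg : p < g by rewrite gt_max g0 andbT /g; lra.
have p0 : 0 <= p by rewrite le_max lexx orbT.
have ps : 1 - s <= p by rewrite le_max lexx.
pose g2 := (p + g) / 2; pose g1 := (g2 + g) / 2.
have pg2 : p < g2 by rewrite /g2; lra.
have g2g1 : g2 < g1 by rewrite /g1 /g2; lra.
have g1g : g1 < g by rewrite /g1 /g2; lra.
have g20 : 0 < g2 by exact: le_lt_trans pg2.
have g10 : 0 < g1 by exact: lt_trans g2g1.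
clearbody p g2 g1.
have [a a0 qcvg] := stepsq_cvg P X A alpha mu iidX stable_mu cvg_mu.
have aa' : alpha < g1^-1 by rewrite -[alpha]invrK ltf_pV2 ?posrE.
have [c c_gt0 Hc] := one_sub_q_ge (stepsq P X) A a alpha
  (stepsq_ge0 P X) (stepsq_le1 P X iidX) A_gt0 a0 alpha_gt0 qcvg
  (cramer_gap P X iidX c0 M c01 cramer) g1^-1 aa'.
pose aw : R := 2 `^ (- g2); pose ae : R := 2 `^ (- s).
have aw0 : 0 < aw by exact: powR_gt0.
have ae0 : 0 < ae by exact: powR_gt0.
have aw1 : aw <= 1 by rewrite ltW// -(powRr0 2) ltr_pow2R oppr_lt0.
pose r1 := 2 * aw * ae.
have r1lt : r1 < 1.
  rewrite /r1 /aw /ae -{1}[2]powRr1// -!powRD ?pnatr_eq0 ?implybT//.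
  by rewrite -[ltRHS](powRr0 2) ltr_pow2R; lra.
have r10 : 0 < r1 by rewrite !mulr_gt0.
pose rho := 2 * aw `^ g1^-1.
have rho1 : 1 < rho.
  rewrite /rho /aw -powRrM -{1}[2]powRr1// -!powRD ?pnatr_eq0 ?implybT//.
  by rewrite -[ltLHS](powRr0 2) ltr_pow2R mulNr subr_gt0 ltr_pdivrMr// mul1r.
have rho0 : 0 < rho by exact: lt_trans rho1.
(* With rho^(m+1) >= 4 each exponential term is O(4^(-k)), still summable after multiplication by
   the block length 2^k. *)
have [m Hm] := exprn_unbounded rho 4 rho1.
have {}Hm : 4 <= rho ^+ m.+1 by apply: le_trans Hm _; rewrite ler_eXn2l.
pose C1 := m.+1`!%:R / (c / 2) ^+ m.+1.
have C10 : 0 <= C1 by rewrite divr_ge0// exprn_ge0// divr_ge0// ltW.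
pose r := Num.max r1 (1 / 2).
have r0 : 0 <= r by rewrite le_max (ltW r10).
have rlt1 : r < 1 by rewrite gt_max r1lt; lra.
pose F k := \big[setU/set0]_(i < 2 ^ k) [set x | `|walk X (2 ^ k + i)%N x| < ae ^+ k].
have mF k : measurable (F k).
  by apply: bigsetU_measurable => i _; exact: (measurable_walk_small P X iidX).
have key : {ae P, forall x, exists K, forall k, (K <= k)%N -> ~ F k x}.
  apply: (@borel_cantelli_geometric _ _ _ P F (16 + 4 * C1) r 2) => //.
  - by rewrite addr_ge0// mulr_ge0.
  - by rewrite r0.
  move=> k k2.
  have wk0 : 0 < aw ^+ k by rewrite exprn_gt0.
  have wk1 : aw ^+ k <= 1 by rewrite exprn_ile1// ltW.
  have ek0 : 0 < ae ^+ k by rewrite exprn_gt0.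
  have wek : aw ^+ k * ae ^+ k <= 1 / 4.
    have -> : aw ^+ k * ae ^+ k = (r1 / 2) ^+ k.
      by rewrite -exprMn; congr (_ ^+ _); rewrite /r1; field.
    apply: (@le_trans _ _ ((1 / 2) ^+ k)).
      by rewrite lerXn2r ?nnegrE//; lra.
    apply: (@le_trans _ _ ((1 / 2) ^+ 2)); last by rewrite expr2; lra.
    by rewrite ler_wiXn2l//; lra.
  have wE := exprn_powR aw g1^-1 k (ltW aw0).
  have sb i : fine (P [set x | `|walk X (2 ^ k + i)%N x| < ae ^+ k]) <=
      16 * (aw ^+ k * ae ^+ k) + 4 * (C1 / 4 ^+ k).
    apply: le_trans (small_ball P X iidX c g1^-1 (aw ^+ k) (ae ^+ k) _ _ wk0 ek0 wek) _.
      by move=> u wu; apply: Hc => //; rewrite wk0.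
    rewrite lerD2l ler_pM2l//.
    pose x := c / 2 * rho ^+ k.
    have x0 : 0 < x by rewrite mulr_gt0 ?divr_gt0// exprn_gt0.
    apply: (@le_trans _ _ (expR (- x))).
      rewrite ler_expR lerN2 wE /x /rho exprMn.
      rewrite (_ : c / 2 * _ = 2 ^+ k * (c * (aw `^ g1^-1) ^+ k) / 2); last by field.
      rewrite !ler_pM2r ?invr_gt0// ?mulr_gt0 ?exprn_gt0 ?powR_gt0//.
      by rewrite -natrX ler_nat leq_addr.
    apply: le_trans (expRN_le _ m x0) _.
    rewrite /C1 -mulrA ler_pM2l ?ltr0n ?fact_gt0// -invfM.
    rewrite lef_pV2 ?posrE ?mulr_gt0 ?exprn_gt0 ?divr_gt0//.
    rewrite /x [leRHS]exprMn ler_pM2l ?exprn_gt0 ?divr_gt0//.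
    by rewrite -exprM mulnC exprM lerXn2r ?nnegrE// exprn_ge0// ltW.
  apply: le_trans (fine_probability_union P (2 ^ k)
    (fun i => [set x | `|walk X (2 ^ k + i)%N x| < ae ^+ k]) (F k) _ _ _) _ => //.
    by move=> i; exact: (measurable_walk_small P X iidX).
  apply: (@le_trans _ _ (\sum_(i < 2 ^ k) (16 * (aw ^+ k * ae ^+ k) + 4 * (C1 / 4 ^+ k)))).
    by apply: ler_sum => i _; exact: sb.
  rewrite sumr_const card_ord -[_ *+ (2 ^ k)]mulr_natl natrX mulrDr [leRHS]mulrDl.
  have rr (z : R) : 0 <= z -> z <= r -> z ^+ k <= r ^+ k.
    by move=> z0 zr; rewrite lerXn2r ?nnegrE.
  apply: lerD.
    have -> : 2 ^+ k * (16 * (aw ^+ k * ae ^+ k)) = 16 * r1 ^+ k.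
      by rewrite /r1 !exprMn; ring.
    by rewrite ler_pM2l// rr ?(ltW r10)// le_max lexx.
  have -> : 2 ^+ k * (4 * (C1 / 4 ^+ k)) = 4 * C1 * (1 / 2) ^+ k.
    have -> : 4 ^+ k = 2 ^+ k * 2 ^+ k :> R by rewrite -exprMn -natrM.
    by rewrite expr_div_n expr1n; field; rewrite expf_neq0.
  by apply: ler_wpM2l; [rewrite mulr_ge0|apply: rr; rewrite ?le_max ?lexx ?orbT//; lra].
move: key; apply: filterS => x [K HK]; exists K => k Kk n /andP[kn nk].
rewrite leNgt; apply/negP => Sn; apply: (HK k Kk).
rewrite /F -(bigcup_mkord (2 ^ k) (fun i => [set x | `|walk X (2 ^ k + i)%N x| < ae ^+ k])).
exists (n - 2 ^ k)%N => /=; last by rewrite subnKC.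
by rewrite ltn_subLR// addnn -mul2n -expnS.
Qed.

(** With M = 2^k, eps = 2^(-s k) and L of order 2^(gam k), tightness makes the sum in [avoids_bound]
    at least M/4. The probability of avoidance is then O(2^(k (gam + s - 1)) + 2^(-k)), which is
    summable. *)
Lemma eventually_close (s : R) : 0 < s -> s < 1 - alpha^-1 ->
  {ae P, forall x, exists K, forall k, (K <= k)%N ->
     exists n, [/\ (0 < n)%N, (n <= 2 ^ k)%N & `|walk X n x| < (2 `^ (- s)) ^+ k]}.
Proof.
move=> s0 s1; pose g := alpha^-1.
have g0 : 0 < g by rewrite invr_gt0.
(* The midpoint of 1/alpha and 1 - s: large enough to dominate the norming constants, small enough
   that gam + s < 1. *)
pose gam := (g + 1 - s) / 2.
have ggam : g < gam by rewrite /gam /g; lra.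
have gams : gam + s < 1 by rewrite /gam /g; lra.
clearbody gam.
have [a a0 qcvg] := stepsq_cvg P X A alpha mu iidX stable_mu cvg_mu.
have ga1 : 1 < gam * alpha by rewrite -ltr_pdivrMr// mul1r.
have gam0 : 0 < gam by exact: lt_trans ggam.
have [C [N0 [C0 HC]]] := norming_growth_le (stepsq P X) A a alpha
  (stepsq_ge0 P X) (stepsq_le1 P X iidX) A_gt0 a0 alpha_gt0 qcvg gam ga1.
have [K K0 [N1 HK]] := tight_walk P X A mu iidX A_gt0 cvg_mu.
pose N := maxn N0 N1.
pose ae : R := 2 `^ (- s).
have ae0 : 0 < ae by exact: powR_gt0.
pose r1 : R := 2 `^ gam / ae / 2.
have r10 : 0 < r1 by rewrite !divr_gt0// powR_gt0.
have r1lt : r1 < 1.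
  rewrite /r1 /ae -powRN opprK -{3}[2]powRr1// -powRN -!powRD ?pnatr_eq0 ?implybT//.
  by rewrite -[ltRHS](powRr0 2) ltr_pow2R; lra.
pose r := Num.max r1 (1 / 2).
have r0 : 0 <= r by rewrite le_max (ltW r10).
have rlt1 : r < 1 by rewrite gt_max r1lt; lra.
have KC0 : 0 < K * C by rewrite mulr_gt0.
have key : {ae P, forall x, exists k0, forall k, (k0 <= k)%N ->
    ~ avoids X (2 ^ k) (ae ^+ k) x}.
  apply: (@borel_cantelli_geometric _ _ _ P _ (8 * (K * C) + 4) r (2 * N)) => //.
  - by move=> k; exact: (measurable_avoids P X iidX).
  - by rewrite addr_ge0// mulr_ge0// ltW.
  - by rewrite r0.
  move=> k Nk.
  have ek0 : 0 < ae ^+ k by rewrite exprn_gt0.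
  pose L := K * C * (2 `^ gam) ^+ k.
  have L0 : 0 <= L by rewrite mulr_ge0 ?(ltW KC0)// exprn_ge0// powR_ge0.
  have NM : (2 * N <= 2 ^ k)%N by rewrite (leq_trans Nk)// ltnW// ltn_expl.
  have half n : (N <= n)%N -> (n <= 2 ^ k)%N ->
      1 / 2 <= fine (P [set x | `|walk X n x| <= L]).
    rewrite geq_max => /andP[N0n N1n] nM.
    have mE z : measurable [set x | `|walk X n x| <= z].
      have := @measurable_fun_ler _ _ _ setT (fun x => `|walk X n x|) (fun=> z)
        (measurableT_comp (@normr_measurable R _) (measurable_walk P X iidX n))
        (measurable_cst _).
      by move=> /(_ measurableT [set true] Logic.I); rewrite setTI.
    apply: le_trans (HK n N1n) _.
    rewrite fine_le ?fin_num_measure//; apply: le_measure; rewrite ?inE//.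
    move=> x /= /le_trans; apply; rewrite /L -mulrA ler_pM2l//.
    apply: le_trans (HC n N0n) _; rewrite ler_pM2l//.
    have -> : (2 `^ gam) ^+ k = (2 ^ k)%N%:R `^ gam :> R.
      by rewrite natrX exprn_powR.
    by apply: ge0_ler_powR; rewrite ?nnegrE ?(ltW gam0)// ler_nat.
  (* Since 2 N <= 2^k, at least half of the times are past [N], and each of them contributes at
     least 1/2. *)
  have sumge : (2 ^ k)%N%:R / 4 <=
      \sum_(n < (2 ^ k).+1) fine (P [set x | `|walk X n x| <= L]).
    rewrite -(big_mkord xpredT (fun n => fine (P [set x | `|walk X n x| <= L]))).
    have NM1 : (N <= (2 ^ k).+1)%N.
      by rewrite leqW// (leq_trans _ NM)// leq_pmull.
    rewrite (big_cat_nat (leq0n N) NM1) /= -[leLHS]add0r; apply: lerD.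
      by apply: sumr_ge0 => n _; rewrite fine_ge0.
    apply: (@le_trans _ _ (\sum_(N <= n < (2 ^ k).+1) (1 / 2))); last first.
      by rewrite ler_sum_nat// => n /andP[Nn nM]; apply: half.
    rewrite sumr_const_nat -[_ *+ (_ - _)]mulr_natl natrB// -[(2 ^ k).+1%:R]natr1.
    have : (2 * N)%N%:R <= (2 ^ k)%N%:R :> R by rewrite ler_nat.
    by rewrite natrM; lra.
  have := avoids_bound P X iidX (2 ^ k) (ae ^+ k) L ek0 L0.
  set pr := fine (P (avoids _ _ _)) => prb.
  have pr0 : 0 <= pr by rewrite fine_ge0.
  have M0 : 0 < 2 ^+ k :> R by rewrite exprn_gt0.
  have {prb} : pr * (2 ^+ k / 4) <= 2 * L / ae ^+ k + 1.
    by apply: le_trans prb; rewrite ler_wpM2l// -natrX.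
  move=> prb; apply: (@le_trans _ _ ((2 * L / ae ^+ k + 1) * 4 / 2 ^+ k)).
    by rewrite ler_pdivlMr//; lra.
  have -> : (2 * L / ae ^+ k + 1) * 4 / 2 ^+ k = 8 * (K * C) * r1 ^+ k + 4 * (1 / 2) ^+ k.
    rewrite /L /r1 !expr_div_n expr1n; field.
    by rewrite !gt_eqF// exprn_gt0.
  have rr (z : R) : 0 <= z -> z <= r -> z ^+ k <= r ^+ k.
    by move=> z0 zr; rewrite lerXn2r ?nnegrE.
  rewrite [leRHS]mulrDl; apply: lerD.
    by rewrite ler_pM2l ?mulr_gt0// rr ?(ltW r10)// le_max lexx.
  by rewrite ler_pM2l//; apply: rr; rewrite ?le_max ?lexx ?orbT//; lra.
move: key; apply: filterS => x [k0 Hk0]; exists k0 => k /Hk0.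
rewrite /avoids /= => /existsNP[n /not_implyP[/andP[n0 nk] /negP]].
by rewrite -ltNge => Sn; exists n.
Qed.

End almost_sure_bounds.

(** * The hitting time *)

Section hitting_time.
Context {d : measure_display} {T : measurableType d} {R : realType}.
Variables (S : nat -> T -> R) (x : T).

Lemma hit_timeP (eps : R) : (exists n, (0 < n)%N && (`|S n x| < eps)) ->
  [/\ (0 < hit_time S eps x)%N, `|S (hit_time S eps x) x| < eps &
      forall n, (0 < n)%N -> `|S n x| < eps -> (hit_time S eps x <= n)%N].
Proof.
move=> ex; rewrite /hit_time; case: pselect => // h.
case: ex_minnP => m /andP[m0 mS] mmin; split => // n n0 nS.
by apply: mmin; rewrite n0.
Qed.

Lemma block_away_late (s : R) K n :
  (forall k, (K <= k)%N -> forall m, (2 ^ k <= m < 2 ^ k.+1)%N ->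
     (2 `^ (- s)) ^+ k <= `|S m x|) ->
  (2 ^ K <= n)%N ->
  exists2 k, (2 ^ k <= n)%N & (2 `^ (- s)) ^+ k <= `|S n x|.
Proof.
move=> away Kn; pose k := trunc_log 2 n.
have n0 : (0 < n)%N by rewrite (leq_trans _ Kn)// expn_gt0.
have kn : (2 ^ k <= n < 2 ^ k.+1)%N.
  by rewrite (trunc_logP (ltnSn 1) n0) (trunc_log_ltn _ (ltnSn 1)).
exists k; first by case/andP: kn.
apply: away => //; rewrite /k trunc_log_max//.
Qed.

(** The finitely many early values are nonzero, hence bounded below, so a small [eps] is hit only in
    a late block. Division by the negative ln eps turns the lower bound on the time into an upper
    bound on the ratio. *)
Lemma hit_time_ge (s : R) : 0 < s -> (forall n, (0 < n)%N -> S n x != 0) ->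
  (exists K, forall k, (K <= k)%N -> forall n, (2 ^ k <= n < 2 ^ k.+1)%N ->
     (2 `^ (- s)) ^+ k <= `|S n x|) ->
  exists2 e1, 0 < e1 & forall eps, 0 < eps -> eps < e1 ->
    (exists n, (0 < n)%N && (`|S n x| < eps)) ->
    ln (hit_time S eps x)%:R / ln eps <= - s^-1.
Proof.
move=> s0 nz [K away].
have [e0 e00 He0] : exists2 e0, 0 < e0 &
    forall n, (0 < n)%N -> (n < 2 ^ K)%N -> e0 <= `|S n x|.
  elim: (2 ^ K)%N => [|m [e0 e00 He0]]; first by exists 1.
  have [->|m0] := posnP m; first by exists 1 => // n; lia.
  exists (Num.min e0 `|S m x|); first by rewrite lt_min e00 normr_gt0 nz.
  move=> n n0; rewrite ltnS leq_eqVlt => /orP[/eqP ->|nm].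
    by rewrite ge_min lexx orbT.
  by rewrite ge_min He0.
exists (Num.min e0 1); first by rewrite lt_min e00 ltr01.
move=> eps eps0; rewrite lt_min => /andP[ee0 e1] /hit_timeP[].
set n := hit_time S eps x => n0 nS _.
have Kn : (2 ^ K <= n)%N.
  rewrite leqNgt; apply/negP => nK.
  by have := le_lt_trans (He0 n n0 nK) nS; rewrite ltNge (ltW ee0).
have [k kn kS] := block_away_late s K n away Kn.
have lneps : ln eps < 0 by rewrite ln_lt0// eps0.
have ln2 : 0 < ln 2 :> R by rewrite ln_gt0// ltr1n.
have nR : 0 < n%:R :> R by rewrite ltr0n.
have h1 : - s * (k%:R * ln 2) < ln eps.
  have := le_lt_trans kS nS; rewrite -ltr_ln ?posrE ?exprn_gt0 ?powR_gt0//.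
  by rewrite lnXn ?powR_gt0// ln_powR -[_ *+ k]mulr_natl mulrCA.
have h2 : k%:R * ln 2 <= ln n%:R :> R.
  have : ln (2 ^ k)%N%:R <= ln n%:R :> R.
    by rewrite ler_ln ?posrE ?ltr0n ?expn_gt0// ler_nat.
  by rewrite natrX lnXn// -[ln 2 *+ k]mulr_natl.
rewrite ler_ndivrMr// mulNr.
rewrite -(ler_pM2l s0) mulrN mulrA divff ?gt_eqF// mul1r.
have : s * (k%:R * ln 2) <= s * ln n%:R by rewrite ler_pM2l.
by move: h1; rewrite mulNr; lra.
Qed.

(** For the least k with rho^k <= eps the hitting time is at most 2^k, while eps < rho^(k-1); the
    index shift costs the vanishing term ln 2 / ln eps. *)
Lemma hit_time_le (s : R) : 0 < s ->
  (exists K, forall k, (K <= k)%N ->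
     exists n, [/\ (0 < n)%N, (n <= 2 ^ k)%N & `|S n x| < (2 `^ (- s)) ^+ k]) ->
  exists2 e1, 0 < e1 & forall eps, 0 < eps -> eps < e1 ->
    (exists n, (0 < n)%N && (`|S n x| < eps)) /\
    - s^-1 + ln 2 / ln eps <= ln (hit_time S eps x)%:R / ln eps.
Proof.
move=> s0 [K close]; pose rho : R := 2 `^ (- s).
have rho0 : 0 < rho by exact: powR_gt0.
have rho1 : rho < 1 by rewrite -[ltRHS](powRr0 2) ltr_pow2R oppr_lt0.
exists (Num.min 1 (rho ^+ K)); first by rewrite lt_min ltr01 exprn_gt0.
move=> eps eps0; rewrite lt_min => /andP[e1 eK].
have exk : exists k, rho ^+ k <= eps.
  have [k Hk] := exprn_unbounded rho^-1 eps^-1 ltac:(by rewrite invf_gt1).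
  by exists k; move: Hk; rewrite exprVn lef_pV2 ?posrE// exprn_gt0.
case: (ex_minnP exk) => k rk kmin.
have Kk : (K < k)%N.
  rewrite ltnNge; apply/negP => kK.
  have : rho ^+ K <= rho ^+ k by rewrite ler_wiXn2l ?ltW.
  by rewrite leNgt (le_lt_trans rk eK).
have [n [n0 nk nS]] := close k (ltnW Kk).
have exn : exists n, (0 < n)%N && (`|S n x| < eps).
  by exists n; rewrite n0 (lt_le_trans nS rk).
split=> //; have [t0 tS tmin] := hit_timeP _ exn.
have tk : (hit_time S eps x <= 2 ^ k)%N.
  by rewrite (leq_trans _ nk)// tmin// (lt_le_trans nS rk).
case: k rk kmin Kk nk nS tk => // k _ kmin _ _ _ tk.
have ek : eps < rho ^+ k.
  by rewrite ltNge; apply/negP => /kmin; rewrite ltnn.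
have lneps : ln eps < 0 by rewrite ln_lt0// eps0.
have ln2 : 0 < ln 2 :> R by rewrite ln_gt0// ltr1n.
have h1 : ln eps < - s * (k%:R * ln 2).
  have : ln eps < ln (rho ^+ k) by rewrite ltr_ln ?posrE ?exprn_gt0.
  by rewrite lnXn// ln_powR -[_ *+ k]mulr_natl mulrCA.
have h2 : ln (hit_time S eps x)%:R <= k.+1%:R * ln 2 :> R.
  apply: (@le_trans _ _ (ln (2 ^ k.+1)%N%:R)).
    by rewrite ler_ln ?posrE ?ltr0n ?expn_gt0// ler_nat.
  by rewrite natrX lnXn// -[ln 2 *+ k.+1]mulr_natl.
rewrite ler_ndivlMr// mulrDl divfK ?lt_eqF//.
apply: le_trans h2 _; rewrite -natr1 mulrDl mul1r lerD2r.
rewrite -(ler_pM2l s0) (_ : s * (- s^-1 * ln eps) = - ln eps); last first.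
  by field; rewrite gt_eqF.
by move: h1; rewrite mulNr; lra.
Qed.

End hitting_time.

Lemma near_right0 {R : realType} (Q : R -> Prop) (e1 : R) : 0 < e1 ->
  (forall eps, 0 < eps -> eps < e1 -> Q eps) -> \forall eps \near 0^'+, Q eps.
Proof.
move=> e10 HQ; near=> eps; apply: HQ.
  by near: eps; exact: nbhs_right_gt.
by near: eps; exact: nbhs_right_lt.
Unshelve. all: by end_near. Qed.

(** * The cases alpha = 1 and alpha > 1 *)

Section cases.
Context {d : measure_display} {T : measurableType d} {R : realType}.
Variables (P : probability T R) (X : nat -> T -> R) (A : nat -> R) (alpha : R).
Variable mu : probability R R.
Hypotheses (iidX : iid P X) (recX : recurrent P (walk X)) (A_gt0 : forall n, 0 < A n).
Hypotheses (stable_mu : stable_law alpha mu).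
Hypothesis cvg_mu : cvg_distribution P (fun n x => walk X n x / A n) mu.
Variables (c0 M0 : R).
Hypothesis c01 : c0 < 1.
Hypothesis cramer : forall t, M0 < `|t| -> Num.sqrt (stepsq P X t) <= c0.

Let away s := eventually_away P X A alpha mu iidX A_gt0 stable_mu cvg_mu c0 M0 s c01 cramer.
Let close s := eventually_close P X A alpha mu iidX A_gt0 stable_mu cvg_mu s.

Let ratio x (eps : R) : R := ln (hit_time (walk X) eps x)%:R / ln eps.

(** A single null set serves all [eps], by restriction to the countable family 1/(j+1); asking for
    times from 1 on excludes S_0 = 0. *)
Lemma recurrent_hits : {ae P, forall x, forall eps : R, 0 < eps ->
  exists n, (0 < n)%N && (`|walk X n x| < eps)}.
Proof.
have : {ae P, forall x, forall j N, exists2 n, (N <= n)%N & `|walk X n x| < j.+1%:R^-1}.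
  by apply: ae_foralln => j; apply: recX.
apply: filterS => x Hx eps eps0.
have eb := archi_boundP (ltW (_ : 0 < eps^-1)).
have {}eb : eps^-1 < (Num.bound eps^-1)%:R by apply: eb; rewrite invr_gt0.
have [n n1 nS] := Hx (Num.bound eps^-1) 1%N.
exists n; rewrite n1 (lt_trans nS)//.
rewrite -[ltRHS]invrK ltf_pV2 ?posrE ?invr_gt0//.
by apply: lt_trans eb _; rewrite ltr_nat.
Qed.

(** For alpha < 1 a negative [s] is admissible in [eventually_away], so |S_n| >= 1 eventually,
    against recurrence at level 1. *)
Lemma index_ge1 : 1 <= alpha.
Proof.
have alpha0 : 0 < alpha by case: stable_mu => /andP[].
rewrite leNgt; apply/negP => alpha1.
have a1 : 1 < alpha^-1 by rewrite invf_gt1.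
pose s := (1 - alpha^-1) / 2.
have s0 : s < 0 by rewrite /s; lra.
have /away Ha : 1 - alpha^-1 < s by rewrite /s; lra.
have Hr := recX 1 ltr01.
have : {ae P, forall x : T, False}.
  move: Ha Hr; apply: filterS2 => x [K Hx] /(_ (2 ^ K)%N)[n Kn nS].
  have [k _ kS] := block_away_late (walk X) x s K n Hx Kn.
  have : 1 <= (2 `^ (- s)) ^+ k :> R.
    by rewrite exprn_ege1// -[leLHS](powRr0 2) ltW// ltr_pow2R oppr_gt0.
  by rewrite leNgt (le_lt_trans kS nS).
move=> [B [mB B0 Bsub]].
have BT : B = setT by apply/seteqP; split => // x _; apply: Bsub => /=; tauto.
by move: B0; rewrite BT probability_setT => /eqP; rewrite eqe oner_eq0.
Qed.

(** Here 1 - 1/alpha = 0, so every s = 1/(j+1) is admissible and the ratio is eventually at most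
    -(j+1). *)
Lemma ratio_cvg_index1 : alpha = 1 ->
  {ae P, forall x, (forall n, (0 < n)%N -> walk X n x != 0) ->
    (ratio x eps)%:E @[eps --> 0^'+] --> -oo%E}.
Proof.
move=> a1.
have : {ae P, forall x, forall j, exists K, forall k, (K <= k)%N ->
    forall n, (2 ^ k <= n < 2 ^ k.+1)%N -> (2 `^ (- j.+1%:R^-1)) ^+ k <= `|walk X n x|}.
  by apply: ae_foralln => j; apply: away; rewrite a1 invr1 subrr.
move: recurrent_hits; apply: filterS2 => x hits awayx nz.
apply/cvgeNyPle => B.
pose j := Num.bound `|B|.
have jB := archi_boundP (normr_ge0 B); rewrite -/j in jB.
have [e1 e10 He1] := hit_time_ge (walk X) x j.+1%:R^-1 ltac:(by []) nz (awayx j).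
apply: (near_right0 _ e1 e10) => eps eps0 epse1.
rewrite lee_fin; apply: le_trans (He1 eps eps0 epse1 (hits eps eps0)) _.
rewrite invrK -natr1; move: jB; have := ler_norm (- B); rewrite normrN; lra.
Qed.

Lemma ratio_cvg_index_gt1 : 1 < alpha ->
  {ae P, forall x, (forall n, (0 < n)%N -> walk X n x != 0) ->
    ratio x eps @[eps --> 0^'+] --> - (alpha / (alpha - 1))}.
Proof.
move=> a1; pose b := 1 - alpha^-1; pose beta := b^-1.
have alpha0 : 0 < alpha by lra.
have b0 : 0 < b by rewrite subr_gt0 invf_lt1.
have betaE : alpha / (alpha - 1) = beta.
  rewrite /beta /b; field; apply/andP; split; lra.
have beta0 : 0 < beta by rewrite invr_gt0.
(* The exponents b / u_j > b and b u_j < b tend to b = 1/beta; a countable family keeps the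
   exceptional set null. *)
pose u j : R := j.+1%:R / j.+2%:R.
have u0 j : 0 < u j by rewrite divr_gt0.
have u1 j : u j < 1 by rewrite ltr_pdivrMr// mul1r ltr_nat.
have : {ae P, forall x, forall j, exists K, forall k, (K <= k)%N ->
    forall n, (2 ^ k <= n < 2 ^ k.+1)%N -> (2 `^ (- (b / u j))) ^+ k <= `|walk X n x|}.
  by apply: ae_foralln => j; apply: away; rewrite -/b ltr_pdivlMr// gtr_pMr.
have : {ae P, forall x, forall j, exists K, forall k, (K <= k)%N ->
    exists n, [/\ (0 < n)%N, (n <= 2 ^ k)%N &
                 `|walk X n x| < (2 `^ (- (b * u j))) ^+ k]}.
  apply: ae_foralln => j; apply: close; first by rewrite mulr_gt0.
  by rewrite -/b gtr_pMr.
apply: filterS2 => x closex awayx nz; rewrite betaE.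
apply/cvgrPdist_le => e e0.
have eb0 : 0 <= 2 * beta / e by rewrite !mulr_ge0 ?invr_ge0 ?(ltW e0)// ltW.
pose j := Num.bound (2 * beta / e).
have jb : 2 * beta / j.+1%:R < e.
  rewrite ltr_pdivrMr// [e * _]mulrC -ltr_pdivrMr//.
  by apply: lt_trans (archi_boundP eb0) _; rewrite ltr_nat.
have [e1 e10 He1] := hit_time_ge (walk X) x (b / u j)
  ltac:(by rewrite divr_gt0) nz (awayx j).
have [e2 e20 He2] := hit_time_le (walk X) x (b * u j)
  ltac:(by rewrite mulr_gt0) (closex j).
have ln2 : 0 < ln 2 :> R by rewrite ln_gt0// ltr1n.
(* Below [e3] the correction ln 2 / ln eps is at least -e/2; the choice of [j] leaves the other half
   for the error in the exponent. *)
pose e3 := expR (- (2 * ln 2 / e)).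
apply: (near_right0 _ (Num.min e1 (Num.min e2 e3))).
  by rewrite !lt_min e10 e20 expR_gt0.
move=> eps eps0; rewrite !lt_min => /and3P[h1 h2 h3].
have [ex lo] := He2 eps eps0 h2.
have hi := He1 eps eps0 h1 ex.
have l3 : ln eps < - (2 * ln 2 / e).
  by rewrite -(expRK (- (2 * ln 2 / e))) ltr_ln ?posrE ?expR_gt0.
have l0 : ln eps < 0.
  by apply: lt_trans l3 _; rewrite oppr_lt0 divr_gt0// mulr_gt0.
have l4 : - (e / 2) <= ln 2 / ln eps.
  rewrite ler_ndivlMr//.
  have : ln eps * (e / 2) <= - (2 * ln 2 / e) * (e / 2).
    by rewrite ler_pM2r ?divr_gt0// ltW.
  rewrite (_ : - (2 * ln 2 / e) * (e / 2) = - ln 2); last by field; rewrite gt_eqF.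
  by lra.
have j2 : 0 < j.+2%:R :> R by [].
have j1 : 0 < j.+1%:R :> R by [].
have [uE vE] : (b / u j)^-1 = beta - beta / j.+2%:R /\
    (b * u j)^-1 = beta + beta / j.+1%:R.
  rewrite /u -[j.+2%:R]natr1 /beta; set z : R := j.+1%:R in j1 *.
  clearbody z; clearbody b.
  by split; field; rewrite ?gt_eqF// addr_gt0.
have jj : beta / j.+2%:R <= beta / j.+1%:R.
  by rewrite ler_pM2l// lef_pV2 ?posrE// ler_nat.
rewrite uE in hi; rewrite vE in lo.
have bj := divr_gt0 beta0 j1; have jb' : 2 * (beta / j.+1%:R) < e by rewrite mulrA.
move: hi lo l4 jj bj jb'; rewrite /ratio /= ler_norml.
move: (ln _%:R / _) (ln 2 / _) (beta / j.+1%:R) (beta / j.+2%:R) => rt z v w.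
by lra.
Qed.

End cases.

Theorem theorem1p1 (d : measure_display) (T : measurableType d) (R : realType)
    (P : probability T R) (X : nat -> T -> R) (A : nat -> R) (alpha : R)
    (mu : probability R R) :
  iid P X ->
  recurrent P (walk X) ->
  (forall n, 0 < A n) ->
  stable_law alpha mu ->
  cvg_distribution P (fun n x => walk X n x / A n) mu ->
  (* Cramer condition: limsup_{|t|->oo} |E[exp(i t X_1)]| < 1 *)
  (exists2 c : R, c < 1 & exists M : R, forall t : R, M < `|t| ->
     Num.sqrt ((\int[P]_x cos (t * X 0%N x)) ^+ 2 +
               (\int[P]_x sin (t * X 0%N x)) ^+ 2) <= c) ->
  {ae P, forall x, (forall n, (0 < n)%N -> walk X n x != 0) ->
     ((fun eps : R => ((ln (hit_time (walk X) eps x)%:R) / ln eps)%:E)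
        @ 0^'+ --> (- conj_exponent alpha)%E)}.
Proof.
move=> iidX recX A0 stable_mu cvg_mu [c c1 [M cramer]].
have : 1 <= alpha by exact: (index_ge1 P X A alpha mu iidX recX A0 stable_mu cvg_mu c M).
(* At alpha = 1 the limit is infinite; for alpha > 1 it is a real limit, transferred to the extended
   reals. *)
rewrite le_eqVlt => /orP[/eqP/esym a1|a1].
  rewrite /conj_exponent a1 eqxx.
  exact: (ratio_cvg_index1 P X A alpha mu iidX recX A0 stable_mu cvg_mu c M c1 cramer).
rewrite /conj_exponent gt_eqF//.
have := ratio_cvg_index_gt1 P X A alpha mu iidX A0 stable_mu cvg_mu c M c1 cramer a1.
apply: filterS => x Hx nz; apply: cvg_EFin; first by near=> eps.
exact: Hx.
Unshelve. all: by end_near. Qed.
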